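(* Let $k$ be an algebraically closed field, let $G$ be an algebraic group over $k$, and let $H$ and $K$ be closed subgroups of $G$ such that one of the following holds: (a) $HK=G$, or (b) $\mathrm{Mod}(H)$ is semisimple. Then for every $G$-module $M$ and every $H$-module $N$, $$\mathrm{Ext}^i_{(G,K)}\left(M,\mathrm{ind}_H^G(N)\right)\cong\mathrm{Ext}^i_{(H,H\cap K)}(M,N)\quad\text{for all } i\ge0,$$ where on the right $M$ is regarded as an $H$-module by restriction.
   Context: Modules are rational modules, $\mathrm{Mod}(A)$ is the category of rational $A$-modules; conventions on algebraic groups follow Jantzen's book ''Representations of Algebraic Groups''. For an algebraic group $A$ and a closed subgroup $C\le A$: an exact sequence of $A$-modules with differentials $d_i:M_i\to M_{i+1}$ is $(A,C)$-exact if $\mathrm{Ker}(d_i)$ is a direct $C$-module summand of $M_i$ for all $i$. An $A$-module $I$ is $(A,C)$-injective if for every $(A,C)$-exact sequence $0\to M_1\xrightarrow{d_1}M_2\to M_3\to0$ and every $A$-homomorphism $f:M_1\to I$ there is an $A$-homomorphism $h:M_2\to I$ with $f=h\circ d_1$. An $(A,C)$-injective resolution of $N$ is an $(A,C)$-exact sequence $0\to N\to I_0\to I_1\to\cdots$ with all $I_j$ being $(A,C)$-injective; these exist. $\mathrm{Ext}^i_{(A,C)}(M,N)$ is the $i$-th cohomology of $0\to\mathrm{Hom}_A(M,I_0)\to\mathrm{Hom}_A(M,I_1)\to\cdots$ (independent of the resolution). The induction functor is $\mathrm{ind}_H^G(N)=(N\otimes k[G])^H$, right adjoint to restriction. *)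

(* Defs.v *)
From HB Require Import structures.
From mathcomp Require Import mpoly.
From mathcomp Require Import all_boot all_order all_algebra.
From mathcomp Require Import boolp classical_sets functions.

Set Implicit Arguments.
Unset Strict Implicit.
Unset Printing Implicit Defensive.

Import GRing.Theory.
Local Open Scope ring_scope.
Local Open Scope quotient_scope.

(* Tensor product over a commutative ring: formal sums of pairs, two of them
   being identified when every bilinear map takes the same value on them. *)
Section Tensor.
Context (R : comNzRingType) (M N : lmodType R).

Definition bilin (P : lmodType R) (f : M -> N -> P) : Prop :=
  (forall n, linear (f^~ n)) /\ (forall m, linear (f m)).

Definition fsval (P : lmodType R) (f : M -> N -> P) (s : seq (M * N)) : P :=
  \sum_(p <- s) f p.1 p.2.

Definition tens_equiv (s t : seq (M * N)) : bool :=
  `[< forall (P : lmodType R) (f : M -> N -> P), bilin f ->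
        fsval f s = fsval f t >].

Lemma tens_equiv_refl : reflexive tens_equiv.
Proof. by move=> s; apply/asboolP. Qed.
Lemma tens_equiv_sym : symmetric tens_equiv.
Proof.
by move=> s t; apply/asboolP/asboolP => h P f bf; rewrite (h P f bf).
Qed.
Lemma tens_equiv_trans : transitive tens_equiv.
Proof.
by move=> t s u /asboolP h1 /asboolP h2; apply/asboolP => P f bf;
  rewrite (h1 P f bf) (h2 P f bf).
Qed.

Canonical tens_equivR :=
  EquivRel tens_equiv tens_equiv_refl tens_equiv_sym tens_equiv_trans.

Definition tensor : Type := {eq_quot tens_equivR}.
HB.instance Definition _ := Choice.copy tensor {eq_quot tens_equivR}.

Definition tens_seq (s : seq (M * N)) : tensor := \pi_({eq_quot tens_equivR}) s.
Definition tens_repr (x : tensor) : seq (M * N) := repr (x : {eq_quot tens_equivR}).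

Definition tens (m : M) (n : N) : tensor := tens_seq [:: (m, n)].

(* For f bilinear this is the linear map on the tensor product induced by f. *)
Definition tlift (P : lmodType R) (f : M -> N -> P) (x : tensor) : P :=
  fsval f (tens_repr x).

Lemma tlift_seq (P : lmodType R) (f : M -> N -> P) s :
  bilin f -> tlift f (tens_seq s) = fsval f s.
Proof.
move=> bf; rewrite /tlift /tens_repr /tens_seq.
have : tens_equivR (repr (\pi_({eq_quot tens_equivR}) s)) s.
  by rewrite -eqmodE reprK.
by move/asboolP; apply.
Qed.

Lemma tens_eq (x y : tensor) :
  (forall (P : lmodType R) (f : M -> N -> P), bilin f -> tlift f x = tlift f y) ->
  x = y.
Proof.
move=> h.
have : \pi_({eq_quot tens_equivR}) (tens_repr x) =
       \pi_({eq_quot tens_equivR}) (tens_repr y).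
  by apply/eqmodP; apply/asboolP.
by rewrite /tens_repr !reprK.
Qed.

Definition tens_add (x y : tensor) := tens_seq (tens_repr x ++ tens_repr y).
Definition tens_scale (c : R) (x : tensor) :=
  tens_seq [seq (c *: p.1, p.2) | p <- tens_repr x].

Lemma tlift_add (P : lmodType R) (f : M -> N -> P) x y : bilin f ->
  tlift f (tens_add x y) = tlift f x + tlift f y.
Proof. by move=> bf; rewrite tlift_seq // /fsval big_cat. Qed.

Lemma bilinZl (P : lmodType R) (f : M -> N -> P) c m n : bilin f ->
  f (c *: m) n = c *: f m n.
Proof.
move=> [h _]; have f0 : f 0 n = 0.
  have /eqP := h n 1 0 0; rewrite /= !scale1r addr0 eq_sym.
  by rewrite -subr_eq0 addrK => /eqP.
by have := h n c m 0; rewrite !addr0 f0 addr0.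
Qed.

Lemma tlift_scale (P : lmodType R) (f : M -> N -> P) c x : bilin f ->
  tlift f (tens_scale c x) = c *: tlift f x.
Proof.
move=> bf; rewrite tlift_seq // /tlift /fsval big_map scaler_sumr.
by apply: eq_bigr => p _; rewrite bilinZl.
Qed.

Definition tens_opp := tens_scale (-1).
Definition tens_zero := tens_seq [::].

Lemma tlift_zero (P : lmodType R) (f : M -> N -> P) : bilin f ->
  tlift f tens_zero = 0.
Proof. by move=> bf; rewrite tlift_seq // /fsval big_nil. Qed.

Lemma tens_addA : associative tens_add.
Proof. by move=> x y z; apply: tens_eq => P f bf; rewrite !tlift_add // addrA. Qed.
Lemma tens_addC : commutative tens_add.
Proof. by move=> x y; apply: tens_eq => P f bf; rewrite !tlift_add // addrC. Qed.
Lemma tens_add0 : left_id tens_zero tens_add.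
Proof.
by move=> x; apply: tens_eq => P f bf; rewrite tlift_add // tlift_zero // add0r.
Qed.
Lemma tens_addN : left_inverse tens_zero tens_opp tens_add.
Proof.
move=> x; apply: tens_eq => P f bf.
by rewrite tlift_add // tlift_scale // tlift_zero // scaleN1r addNr.
Qed.
HB.instance Definition _ :=
  GRing.isZmodule.Build tensor tens_addA tens_addC tens_add0 tens_addN.

Lemma tens_scaleA a b (x : tensor) :
  tens_scale a (tens_scale b x) = tens_scale (a * b) x.
Proof. by apply: tens_eq => P f bf; rewrite !tlift_scale // scalerA. Qed.
Lemma tens_scale1 : left_id 1 tens_scale.
Proof. by move=> x; apply: tens_eq => P f bf; rewrite !tlift_scale // scale1r. Qed.
Lemma tens_scaleDr : right_distributive tens_scale +%R.
Proof.
move=> a x y; apply: tens_eq => P f bf.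
by rewrite tlift_scale // !tlift_add // !tlift_scale // scalerDr.
Qed.
Lemma tens_scaleDl x : {morph tens_scale^~ x : a b / a + b}.
Proof.
move=> a b; apply: tens_eq => P f bf.
by rewrite tlift_scale // !tlift_add // !tlift_scale // scalerDl.
Qed.
HB.instance Definition _ := GRing.Zmodule_isLmodule.Build R tensor
  tens_scaleA tens_scale1 tens_scaleDr tens_scaleDl.

Lemma linear_tlift (P : lmodType R) (f : M -> N -> P) :
  bilin f -> linear (tlift f).
Proof.
move=> bf a x y.
by rewrite -[a *: x + y]/(tens_add (tens_scale a x) y) tlift_add ?tlift_scale.
Qed.

Lemma tliftE (P : lmodType R) (f : M -> N -> P) m n :
  bilin f -> tlift f (tens m n) = f m n.
Proof. by move=> bf; rewrite tlift_seq // /fsval big_seq1. Qed.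

Lemma bilin_tens : bilin tens.
Proof.
split=> [n a x y | m a x y]; apply: tens_eq => P f bf;
  rewrite (linear_tlift bf) !tliftE //.
- by case: bf => ->.
- by case: bf => _ ->.
Qed.

Lemma tens_sum (x : tensor) : x = \sum_(p <- tens_repr x) tens p.1 p.2.
Proof.
apply: tens_eq => P f bf.
have tl : forall s, tlift f (\sum_(p <- s) tens p.1 p.2) = fsval f s.
  elim=> [|p s IH]; first by rewrite big_nil /fsval big_nil (tlift_zero bf).
  rewrite big_cons /fsval big_cons.
  have := linear_tlift bf 1 (tens p.1 p.2) (\sum_(p <- s) tens p.1 p.2).
  by rewrite !scale1r => ->; rewrite tliftE // IH.
by rewrite tl.
Qed.

End Tensor.

Notation "M ⊗ N" := (tensor M N) (at level 40, left associativity) : type_scope.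

Section TensorMaps.
Context (R : comNzRingType).
Implicit Types M N P Q : lmodType R.

Definition tmap M N P Q (f : M -> P) (g : N -> Q) : M ⊗ N -> P ⊗ Q :=
  tlift (fun m n => tens (f m) (g n)).

Definition tassoc M N P : (M ⊗ N) ⊗ P -> M ⊗ (N ⊗ P) :=
  tlift (fun x p => tlift (fun m n => tens m (tens n p)) x).

Lemma lin_id M : linear (fun x : M => x).
Proof. by []. Qed.

Lemma lin_comp M N P (g : N -> P) (f : M -> N) :
  linear g -> linear f -> linear (fun x => g (f x)).
Proof. by move=> lg lf a x y; rewrite lf lg. Qed.

Lemma lin_bundled M N (f : {linear M -> N}) : linear (fun x => f x).
Proof. exact: linearP. Qed.

Lemma lin_tensl M N (n : N) : linear (fun m : M => tens m n).
Proof. exact: (bilin_tens M N).1. Qed.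

Lemma lin_tensr M N (m : M) : linear (fun n : N => tens m n).
Proof. exact: (bilin_tens M N).2. Qed.

Lemma lin_tlift_param M N P Q (F : Q -> M -> N -> P) (z : M ⊗ N) :
  (forall m n, linear (fun x => F x m n)) -> linear (fun x => tlift (F x) z).
Proof.
move=> h a x y; rewrite /tlift /fsval scaler_sumr -big_split /=.
by apply: eq_bigr => p _; rewrite (h p.1 p.2).
Qed.

Lemma lin_tlift M N P (f : M -> N -> P) :
  (forall n, linear (fun m => f m n)) -> (forall m, linear (fun n => f m n)) ->
  linear (fun x => tlift f x).
Proof. by move=> h1 h2; apply: linear_tlift; split. Qed.

Lemma lin_scale M N (c : R) (f : M -> N) :
  linear f -> linear (fun x => c *: f x).
Proof. by move=> lf a x y; rewrite lf scalerDr !scalerA mulrC. Qed.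

Lemma lin_scalel M N (f : M -> R^o) (v : N) :
  linear f -> linear (fun x => (f x : R) *: v).
Proof. by move=> lf a x y; rewrite lf scalerDl scalerA. Qed.

Lemma lin_add M N (f g : M -> N) :
  linear f -> linear g -> linear (fun x => f x + g x).
Proof. by move=> lf lg a x y; rewrite lf lg scalerDr addrACA. Qed.

Lemma lin_opp M N (f : M -> N) : linear f -> linear (fun x => - f x).
Proof. by move=> lf a x y; rewrite lf opprD scalerN. Qed.

Lemma lin0 M N (f : M -> N) : linear f -> f 0 = 0.
Proof.
move=> lf; have /eqP := lf 1 0 0; rewrite !scale1r addr0 eq_sym.
by rewrite -subr_eq0 addrK => /eqP.
Qed.

Lemma linD M N (f : M -> N) x y : linear f -> f (x + y) = f x + f y.
Proof. by move=> lf; have := lf 1 x y; rewrite !scale1r. Qed.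

Lemma linZ M N (f : M -> N) a x : linear f -> f (a *: x) = a *: f x.
Proof. by move=> lf; have := lf a x 0; rewrite (lin0 lf) !addr0. Qed.

Lemma lin_sum M N (f : M -> N) I (r : seq I) (F : I -> M) : linear f ->
  f (\sum_(i <- r) F i) = \sum_(i <- r) f (F i).
Proof.
move=> lf; elim: r => [|i r IH]; first by rewrite !big_nil lin0.
by rewrite !big_cons linD // IH.
Qed.

Lemma lin_mull (A : comAlgType R) M (f : M -> A) (c : A) :
  linear f -> linear (fun x => f x * c).
Proof. by move=> lf a x y; rewrite lf mulrDl scalerAl. Qed.

Lemma lin_mulr (A : comAlgType R) M (c : A) (f : M -> A) :
  linear f -> linear (fun x => c * f x).
Proof. by move=> lf a x y; rewrite lf mulrDr scalerAr. Qed.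

Lemma lin_alg (A : comAlgType R) M (f : M -> R^o) :
  linear f -> linear (fun x => (f x : R)%:A : A).
Proof. by move=> lf; apply: lin_scalel. Qed.

End TensorMaps.

Ltac lin_step :=
  match goal with
  | |- _ => eassumption
  | |- linear (fun x => x) => exact: lin_id
  | |- linear (fun x => tlift (fun m n => @?LF x m n) ?Lz) =>
      refine (@lin_tlift_param _ _ _ _ _ LF Lz _) => ? ? /=
  | |- linear (fun x => tlift ?Lf x) =>
      refine (@lin_tlift _ _ _ _ Lf _ _) => ? /=
  | |- linear (tlift ?Lf) => refine (@lin_tlift _ _ _ _ Lf _ _) => ? /=
  | |- linear (fun x => tlift ?Lf (@?Lg x)) =>
      refine (@lin_comp _ _ _ _ (fun y => tlift Lf y) Lg _ _)
  | |- linear (fun x => tens x ?Ln) => exact: lin_tensl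
  | |- linear (fun x => tens ?Lm x) => exact: lin_tensr
  | |- linear (tens ?Lm) => exact: lin_tensr
  | |- linear (fun x => tens (@?Lf x) ?Ln) =>
      refine (@lin_comp _ _ _ _ (fun y => tens y Ln) Lf _ _)
  | |- linear (fun x => tens ?Lm (@?Lf x)) =>
      refine (@lin_comp _ _ _ _ (fun y => tens Lm y) Lf _ _)
  | |- linear (fun x => @?Lf x + @?Lg x) => refine (@lin_add _ _ _ Lf Lg _ _)
  | |- linear (fun x => - @?Lf x) => refine (@lin_opp _ _ _ Lf _)
  | |- linear (fun x => (@?Lf x)%:A) => refine (@lin_alg _ _ _ Lf _) => /=
  | |- linear (fun x => ?Lc *: @?Lf x) => refine (@lin_scale _ _ _ Lc Lf _)
  | |- linear (fun x => @?Lf x *: ?Lv) => refine (@lin_scalel _ _ _ Lf Lv _) => /=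
  | |- linear (fun x => @?Lf x * ?Lc) => refine (@lin_mull _ _ _ Lf Lc _)
  | |- linear (fun x => ?Lc * @?Lf x) => refine (@lin_mulr _ _ _ Lc Lf _)
  | |- linear (fun x => ?Lf x) => exact: linearP
  | |- linear (fun x => tmap ?Lf ?Lg (@?Lh x)) => rewrite /tmap /=
  | |- linear (tmap ?Lf ?Lg) => rewrite /tmap /=
  | |- linear (fun x => tassoc (@?Lh x)) => rewrite /tassoc /=
  | |- linear (fun x => ?Lf (@?Lg x)) =>
      refine (@lin_comp _ _ _ _ (fun y => Lf y) Lg _ _)
  | |- linear _ => exact: linearP
  end.
Ltac lin := repeat (cbv beta; lin_step).
Ltac tE := rewrite tliftE; last by [split=> ? /=; lin].

Section TensorMaps2.
Context (R : comNzRingType).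
Implicit Types M N P Q : lmodType R.

Lemma tens_ext M N P (f g : M ⊗ N -> P) : linear f -> linear g ->
  (forall m n, f (tens m n) = g (tens m n)) -> f =1 g.
Proof.
move=> lf lg h x; rewrite (tens_sum x) !lin_sum //.
by apply: eq_bigr => p _; apply: h.
Qed.

Lemma tmapE M N P Q (f : M -> P) (g : N -> Q) m n :
  linear f -> linear g -> tmap f g (tens m n) = tens (f m) (g n).
Proof. by move=> lf lg; rewrite /tmap; tE. Qed.

Lemma lin_tmap M N P Q (f : M -> P) (g : N -> Q) :
  linear f -> linear g -> linear (tmap f g).
Proof. by move=> lf lg; lin. Qed.

Lemma tassocE M N P (m : M) (n : N) (p : P) :
  tassoc (tens (tens m n) p) = tens m (tens n p).
Proof. by rewrite /tassoc; tE; tE. Qed.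

Lemma lin_tassoc M N P : linear (@tassoc R M N P).
Proof. by rewrite /tassoc; lin. Qed.

End TensorMaps2.

Section AlgebraTensor.
Context (k : fieldType).

Definition tens_mul (A B : comAlgType k) (x y : A ⊗ B) : A ⊗ B :=
  tlift (fun a b => tlift (fun c d => tens (a * c) (b * d)) y) x.

(* The R-module structure on M ⊗ R. *)
Definition tscale (M : lmodType k) (R : comAlgType k) (r : R) : M ⊗ R -> M ⊗ R :=
  tlift (fun m s => tens m (r * s)).

Lemma lin_tscale (M : lmodType k) (R : comAlgType k) (r : R) :
  linear (@tscale M R r).
Proof. by rewrite /tscale; lin. Qed.

Lemma tscaleE (M : lmodType k) (R : comAlgType k) (r s : R) (m : M) :
  tscale r (tens m s) = tens m (r * s).
Proof. by rewrite /tscale; tE. Qed.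

Lemma lin_tscalel (M : lmodType k) (R : comAlgType k) (x : M ⊗ R) :
  linear (fun r : R => tscale r x).
Proof. by rewrite /tscale; lin. Qed.

Lemma tmap_tscale (M M' : lmodType k) (R : comAlgType k) (f : M -> M') r
    (x : M ⊗ R) : linear f ->
  tmap f id (tscale r x) = tscale r (tmap f id x).
Proof.
move=> lf; move: x; apply: tens_ext => [||m s].
- by apply: (lin_comp (g := tmap f id)); [apply: lin_tmap | apply: lin_tscale].
- by apply: (lin_comp (f := tmap f id)); [apply: lin_tscale | apply: lin_tmap].
- by rewrite tscaleE !tmapE // tscaleE.
Qed.

End AlgebraTensor.

(* A k-group scheme, affine and of finite type over k, given by its
   (commutative) coordinate Hopf algebra k[G]; k[G] need not be reduced. *)
Record algGroup (k : fieldType) := AlgGroup {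
  coord :> comAlgType k;
  comul : {linear coord -> coord ⊗ coord};
  counit : {lrmorphism coord -> k^o};
  antipode : {lrmorphism coord -> coord};
  comul1 : comul 1 = tens 1 1;
  comulM : forall a b, comul (a * b) = tens_mul (comul a) (comul b);
  coassoc : forall a,
    tassoc (tmap comul id (comul a)) = tmap id comul (comul a);
  counitl : forall a, tlift (fun a1 a2 => (counit a1 : k) *: a2) (comul a) = a;
  counitr : forall a, tlift (fun a1 a2 => (counit a2 : k) *: a1) (comul a) = a;
  antipodel : forall a,
    tlift (fun a1 a2 => antipode a1 * a2) (comul a) = (counit a : k)%:A;
  antipoder : forall a,
    tlift (fun a1 a2 => a1 * antipode a2) (comul a) = (counit a : k)%:A;
  fin_gen : exists (n : nat) (x : 'I_n -> coord), forall a : coord,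
    exists p : {mpoly k[n]}, a = mmap (in_alg coord) x p
}.

(* R-valued points of G; the group law of G(R) is dual to the Hopf structure.
   A comAlgType is never the zero ring; nothing is lost, since G(0) is a point
   and M ⊗ 0 = 0. *)
Definition gpoint (k : fieldType) (G : algGroup k) (R : comAlgType k) : Type :=
  {lrmorphism G -> R}.

Section Points.
Context (k : fieldType) (G : algGroup k).

Definition gmul_fun (R : comAlgType k) (g h : G -> R) : G -> R :=
  fun a => tlift (fun a1 a2 => g a1 * h a2) (comul G a).

Definition gone_fun (R : comAlgType k) : G -> R :=
  fun a => (counit G a : k)%:A.

Section Laws.
Context (R : comAlgType k).
Implicit Types g h u : gpoint G R.

Lemma gmul_linear g h : linear (gmul_fun g h).
Proof. by rewrite /gmul_fun; lin. Qed.

Lemma tlift_mul g h (x y : G ⊗ G) :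
  tlift (fun a b => g a * h b) (tens_mul x y) =
  tlift (fun a b => g a * h b) x * tlift (fun a b => g a * h b) y.
Proof.
move: x; apply: tens_ext => [||a b]; first by rewrite /tens_mul; lin.
  by lin.
move: y; apply: tens_ext => [||c d]; first by rewrite /tens_mul; lin.
  by lin.
rewrite /tens_mul; do 2!tE; rewrite !tliftE; try by split=> ? /=; lin.
by rewrite !rmorphM mulrACA.
Qed.

Lemma gmul_monoid g h : monoid_morphism (gmul_fun g h).
Proof.
split=> [|a b]; first by rewrite /gmul_fun comul1; tE; rewrite !rmorph1 mulr1.
by rewrite /gmul_fun comulM tlift_mul.
Qed.

HB.instance Definition _ g h :=
  GRing.isLinear.Build k G R *:%R (gmul_fun g h) (gmul_linear g h).
HB.instance Definition _ g h :=
  GRing.isMonoidMorphism.Build G R (gmul_fun g h) (gmul_monoid g h).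

Lemma gone_linear : linear (@gone_fun R).
Proof. by rewrite /gone_fun; lin. Qed.

Lemma gone_monoid : monoid_morphism (@gone_fun R).
Proof.
split=> [|a b]; rewrite /gone_fun ?rmorph1 ?scale1r //.
by rewrite rmorphM -scalerAl mul1r scalerA.
Qed.

HB.instance Definition _ :=
  GRing.isLinear.Build k G R *:%R (@gone_fun R) gone_linear.
HB.instance Definition _ :=
  GRing.isMonoidMorphism.Build G R (@gone_fun R) gone_monoid.

Definition gmul g h : gpoint G R := gmul_fun g h : {lrmorphism _ -> _}.
Definition gone : gpoint G R := @gone_fun R : {lrmorphism _ -> _}.
Definition ginv g : gpoint G R := (g \o antipode G) : {lrmorphism _ -> _}.

Lemma gmulA g h u : gmul g (gmul h u) =1 gmul (gmul g h) u.
Proof.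
move=> a; pose F := fun x : G ⊗ (G ⊗ G) =>
  tlift (fun a1 y => g a1 * tlift (fun a2 a3 => h a2 * u a3) y) x.
have lF : linear F by rewrite /F; lin.
transitivity (F (tmap id (comul G) (comul G a))).
  rewrite /= /gmul_fun /F; move: (comul G a); apply: tens_ext => [||b c].
  - by lin.
  - by lin.
  - by rewrite tmapE //; [tE; tE | exact: linearP].
rewrite -coassoc /= /gmul_fun /F; move: (comul G a); apply: tens_ext => [||b c].
- by lin.
- by lin.
- rewrite tmapE //; last exact: linearP.
  tE; move: (comul G b); apply: tens_ext => [||d e]; [by lin|by lin|].
  by rewrite tassocE; do 3!tE; rewrite mulrA.
Qed.

Lemma gmul1 g : gmul g gone =1 g.
Proof.
move=> a; rewrite /= /gmul_fun -[in RHS](counitr a).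
move: (comul G a); apply: tens_ext => [||b c]; [by lin|by lin|].
by tE; tE; rewrite /= /gone_fun linearZ -scalerAr mulr1.
Qed.

Lemma g1mul g : gmul gone g =1 g.
Proof.
move=> a; rewrite /= /gmul_fun -[in RHS](counitl a).
move: (comul G a); apply: tens_ext => [||b c]; [by lin|by lin|].
by tE; tE; rewrite /= /gone_fun linearZ -scalerAl mul1r.
Qed.

Lemma gmulV g : gmul g (ginv g) =1 gone.
Proof.
move=> a; rewrite /= /gone_fun.
have -> : (counit G a : k)%:A = g ((counit G a : k)%:A).
  by rewrite linearZ /= rmorph1.
rewrite -antipoder /= /gmul_fun.
move: (comul G a); apply: tens_ext => [||b c]; [by lin|by lin|].
by tE; tE; rewrite rmorphM.
Qed.

Lemma gmulVl g : gmul (ginv g) g =1 gone.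
Proof.
move=> a; rewrite /= /gone_fun.
have -> : (counit G a : k)%:A = g ((counit G a : k)%:A).
  by rewrite linearZ /= rmorph1.
rewrite -antipodel /= /gmul_fun.
move: (comul G a); apply: tens_ext => [||b c]; [by lin|by lin|].
by tE; tE; rewrite rmorphM.
Qed.

Lemma eq_gmul g g' h h' : g =1 g' -> h =1 h' -> gmul g h =1 gmul g' h'.
Proof.
move=> e1 e2 a; rewrite /= /gmul_fun /tlift /fsval.
by apply: eq_bigr => p _; rewrite e1 e2.
Qed.

Lemma ginv_uniq g h : gmul g h =1 gone -> ginv g =1 h.
Proof.
move=> e a; rewrite -(gmul1 (ginv g) a).
have e' : gone =1 gmul g h by move=> b; rewrite e.
rewrite (eq_gmul (frefl (ginv g)) e') gmulA.
by rewrite (eq_gmul (@gmulVl g) (frefl h)) g1mul.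
Qed.

Lemma ginvM g h : ginv (gmul g h) =1 gmul (ginv h) (ginv g).
Proof.
apply: ginv_uniq => a; rewrite gmulA.
have e : gmul (gmul g h) (ginv h) =1 g.
  move=> b; rewrite -gmulA (eq_gmul (frefl g) (@gmulV h)); exact: gmul1.
by rewrite (eq_gmul e (frefl (ginv g))) gmulV.
Qed.

Lemma ginv1 : ginv gone =1 gone.
Proof. by apply: ginv_uniq => a; rewrite gmul1. Qed.

End Laws.
End Points.

(* A closed subgroup scheme of G: an ideal of k[G] whose zero locus is a
   subgroup of G(R) for every R. *)
Definition vanishes (k : fieldType) (G : algGroup k) (I : G -> Prop)
    (R : comAlgType k) (g : gpoint G R) : Prop :=
  forall a, I a -> g a = 0.

Record closedSubgroup (k : fieldType) (G : algGroup k) := ClosedSubgroup {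
  idl : G -> Prop;
  idl0 : idl 0;
  idlD : forall a b, idl a -> idl b -> idl (a + b);
  idlM : forall a b, idl b -> idl (a * b);
  idl_one : forall R : comAlgType k, vanishes idl (gone G R);
  idl_mul : forall (R : comAlgType k) (g h : gpoint G R),
    vanishes idl g -> vanishes idl h -> vanishes idl (gmul g h);
  idl_inv : forall (R : comAlgType k) (g : gpoint G R),
    vanishes idl g -> vanishes idl (ginv g)
}.

Definition mem_point (k : fieldType) (G : algGroup k) (H : closedSubgroup G)
    (R : comAlgType k) (g : gpoint G R) : Prop := vanishes (@idl k G H) g.

Definition subgroup_le (k : fieldType) (G : algGroup k)
    (L H : closedSubgroup G) : Prop := forall a, idl H a -> idl L a.

Section Subgroups.
Context (k : fieldType) (G : algGroup k).

Lemma mem_le (L H : closedSubgroup G) (R : comAlgType k) (g : gpoint G R) :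
  subgroup_le L H -> mem_point L g -> mem_point H g.
Proof. by move=> le Lg a Ha; apply/Lg/le. Qed.

Lemma vanishes0 (R : comAlgType k) (g : gpoint G R) :
  vanishes (fun a => a = 0) g.
Proof. by move=> a ->; rewrite raddf0. Qed.

Definition fullG : closedSubgroup G.
Proof.
refine (@ClosedSubgroup k G (fun a => a = 0) erefl _ _ _ _ _).
- by move=> a b -> ->; rewrite addr0.
- by move=> a b ->; rewrite mulr0.
- by move=> R; apply: vanishes0.
- by move=> R g h _ _; apply: vanishes0.
- by move=> R g _; apply: vanishes0.
Defined.

Lemma le_full (H : closedSubgroup G) : subgroup_le H fullG.
Proof. by move=> a ->; apply: idl0. Qed.

(* Scheme-theoretic intersection: its ideal is the sum of the ideals, so that
   (H ∩ K)(R) = H(R) ∩ K(R). *)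
Definition capG_idl (H K : closedSubgroup G) (c : G) : Prop :=
  exists a b, [/\ idl H a, idl K b & c = a + b].

Lemma vanishes_cap (H K : closedSubgroup G) (R : comAlgType k) (g : gpoint G R) :
  vanishes (capG_idl H K) g <-> mem_point H g /\ mem_point K g.
Proof.
split=> [h|[Hg Kg] c [a [b [Ha Kb ->]]]].
  split=> a aI; apply: h.
    by exists a, 0; rewrite addr0; split=> //; apply: idl0.
  by exists 0, a; rewrite add0r; split=> //; apply: idl0.
by rewrite raddfD /= (Hg _ Ha) (Kg _ Kb) addr0.
Qed.

Definition capG (H K : closedSubgroup G) : closedSubgroup G.
Proof.
refine (@ClosedSubgroup k G (capG_idl H K) _ _ _ _ _ _).
- by exists 0, 0; rewrite addr0; split=> //; apply: idl0.
- move=> _ _ [a [b [Ha Kb ->]]] [a' [b' [Ha' Kb' ->]]].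
  by exists (a + a'), (b + b'); rewrite addrACA; split=> //; apply: idlD.
- move=> c _ [a [b [Ha Kb ->]]].
  by exists (c * a), (c * b); rewrite mulrDr; split=> //; apply: idlM.
- by move=> R; apply/vanishes_cap; split; apply: idl_one.
- move=> R g h /vanishes_cap[Hg Kg] /vanishes_cap[Hh Kh].
  by apply/vanishes_cap; split; apply: idl_mul.
- move=> R g /vanishes_cap[Hg Kg].
  by apply/vanishes_cap; split; apply: idl_inv.
Defined.

Lemma capG_lel (H K : closedSubgroup G) : subgroup_le (capG H K) H.
Proof. by move=> a Ha; exists a, 0; rewrite addr0; split=> //; apply: idl0. Qed.

Lemma capG_ler (H K : closedSubgroup G) : subgroup_le (capG H K) K.
Proof. by move=> a Ka; exists 0, a; rewrite add0r; split=> //; apply: idl0. Qed.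

End Subgroups.

Arguments le_full {k G} H a _.
Arguments capG_lel {k G} H K a _.
Arguments capG_ler {k G} H K a _.

Section RestrictScalars.
Context (R S : comNzRingType) (phi : {rmorphism R -> S}).

Definition rscal : Type := let _ := phi in S.
HB.instance Definition _ := GRing.Zmodule.on rscal.

Definition rscale (r : R) (s : rscal) : rscal := phi r * (s : S).

Lemma rscaleA a b s : rscale a (rscale b s) = rscale (a * b) s.
Proof. by rewrite /rscale rmorphM mulrA. Qed.
Lemma rscale1 : left_id 1 rscale.
Proof. by move=> s; rewrite /rscale rmorph1 mul1r. Qed.
Lemma rscaleDr : right_distributive rscale +%R.
Proof. by move=> a x y; rewrite /rscale mulrDr. Qed.
Lemma rscaleDl s : {morph rscale^~ s : a b / a + b}.
Proof. by move=> a b; rewrite /rscale rmorphD mulrDl. Qed.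
HB.instance Definition _ := GRing.Zmodule_isLmodule.Build R rscal
  rscaleA rscale1 rscaleDr rscaleDl.

Definition exact_pair (U V W : zmodType) (u : U -> V) (v : V -> W) : Prop :=
  forall y, v y = 0 <-> exists x, u x = y.

Definition faithfully_flat : Prop :=
  forall (U V W : lmodType R) (u : {linear U -> V}) (v : {linear V -> W}),
    exact_pair u v <->
    exact_pair (tmap u id : U ⊗ rscal -> V ⊗ rscal)
               (tmap v id : V ⊗ rscal -> W ⊗ rscal).

Definition finitely_presented : Prop :=
  exists (n : nat) (t : 'I_n -> S),
    (forall s : S, exists p : {mpoly R[n]}, s = mmap phi t p) /\
    exists (m : nat) (f : 'I_m -> {mpoly R[n]}), forall p : {mpoly R[n]},
      mmap phi t p = 0 <->
      exists c : 'I_m -> {mpoly R[n]}, p = \sum_j c j * f j.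

Definition fppf : Prop := faithfully_flat /\ finitely_presented.

End RestrictScalars.

(* HK = G: the multiplication morphism H × K -> G is an epimorphism of fppf
   sheaves, i.e. every point of G is, fppf-locally, a product of a point of H
   and a point of K. *)
Definition product_is_full (k : fieldType) (G : algGroup k)
    (H K : closedSubgroup G) : Prop :=
  forall (R : comAlgType k) (g : gpoint G R),
    exists (S : comAlgType k) (phi : {lrmorphism R -> S}), fppf phi /\
    exists h x : gpoint G S,
      [/\ mem_point H h, mem_point K x & forall a, phi (g a) = gmul h x a].

Section Subspaces.
Context (k : fieldType).

Definition subspace (V : lmodType k) (W : V -> Prop) : Prop :=
  W 0 /\ forall (c : k) x y, W x -> W y -> W (c *: x + y).

(* The image of W ⊗ R in V ⊗ R. *)
Definition tens_sub (V R : lmodType k) (W : V -> Prop)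
    (z : V ⊗ R) : Prop :=
  exists s : seq (V * R),
    (forall p, p \in s -> W p.1) /\ z = \sum_(p <- s) tens p.1 p.2.

End Subspaces.

(* A rational H-module in the functorial sense: H(R) acts R-linearly on M ⊗ R,
   functorially in R. The value of act at points of G outside H(R) is
   irrelevant: no axiom or definition looks at it. *)
Record gmodule (k : fieldType) (G : algGroup k) (H : closedSubgroup G) :=
  GModule {
  gcar :> lmodType k;
  act : forall R : comAlgType k, gpoint G R -> gcar ⊗ R -> gcar ⊗ R;
  act_lin : forall (R : comAlgType k) (g : gpoint G R), mem_point H g ->
    forall (r : R) (x y : gcar ⊗ R),
      act g (tscale r x + y) = tscale r (act g x) + act g y;
  act_one : forall (R : comAlgType k) (x : gcar ⊗ R), act (gone G R) x = x;
  act_mul : forall (R : comAlgType k) (g h : gpoint G R),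
    mem_point H g -> mem_point H h ->
    forall x : gcar ⊗ R, act (gmul g h) x = act g (act h x);
  act_nat : forall (R S : comAlgType k) (phi : {lrmorphism R -> S})
      (g : gpoint G R) (g' : gpoint G S), mem_point H g ->
    (forall a, g' a = phi (g a)) ->
    forall x : gcar ⊗ R, tmap id phi (act g x) = act g' (tmap id phi x)
}.

Section Modules.
Context (k : fieldType) (G : algGroup k).
Implicit Types H L : closedSubgroup G.

Definition res L H (LH : subgroup_le L H) (M : gmodule H) : gmodule L :=
  @GModule k G L M (@act k G H M)
    (fun R g Lg => @act_lin k G H M R g (mem_le LH Lg))
    (@act_one k G H M)
    (fun R g h Lg Lh => @act_mul k G H M R g h (mem_le LH Lg) (mem_le LH Lh))
    (fun R S phi g g' Lg => @act_nat k G H M R S phi g g' (mem_le LH Lg)).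

Definition ghom H (M N : gmodule H) (f : M -> N) : Prop :=
  linear f /\
  forall (R : comAlgType k) (g : gpoint G R), mem_point H g ->
    forall x : M ⊗ R, tmap f id (act g x) = act g (tmap f id x).

Definition gsubmod H (M : gmodule H) (W : M -> Prop) : Prop :=
  subspace W /\
  forall (R : comAlgType k) (g : gpoint G R), mem_point H g ->
    forall x : M ⊗ R, tens_sub W x -> tens_sub W (act g x).

Definition gsimple H (M : gmodule H) (W : M -> Prop) : Prop :=
  [/\ gsubmod W, exists x, W x /\ x <> 0 &
      forall U : M -> Prop, gsubmod U -> (forall x, U x -> W x) ->
        (forall x, U x -> x = 0) \/ (forall x, W x -> U x)].

Definition semisimple H (M : gmodule H) : Prop :=
  exists (I : eqType) (W : I -> M -> Prop),
    [/\ forall i, gsimple (W i),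
        forall m : M, exists (s : seq I) (x : I -> M),
          (forall i, W i (x i)) /\ m = \sum_(i <- s) x i
      & forall (s : seq I) (x : I -> M), uniq s -> (forall i, W i (x i)) ->
          \sum_(i <- s) x i = 0 -> forall i, i \in s -> x i = 0].

Definition Mod_semisimple H : Prop := forall M : gmodule H, semisimple M.

Definition is_summand C (M : gmodule C) (W : M -> Prop) : Prop :=
  gsubmod W /\
  exists U : M -> Prop,
    [/\ gsubmod U, forall x, exists w u, [/\ W w, U u & x = w + u]
      & forall x, W x -> U x -> x = 0].

Section Relative.
Context (A C : closedSubgroup G) (CA : subgroup_le C A).

(* Exactness of L -> M -> N at M, the kernel at M being a C-summand. *)
Definition rel_exact_at (L M N : gmodule A) (f : L -> M) (g : M -> N) : Prop :=
  exact_pair f g /\ is_summand (M := res CA M) (fun x => g x = 0).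

(* (A,C)-exactness of 0 -> M1 -> M2 -> M3 -> 0. The kernels at M1 and M3 are
   0 and M3, which are summands for trivial reasons. *)
Definition rel_short_exact (M1 M2 M3 : gmodule A)
    (d1 : M1 -> M2) (d2 : M2 -> M3) : Prop :=
  [/\ forall x, d1 x = 0 -> x = 0, rel_exact_at d1 d2
    & forall z, exists y, d2 y = z].

Definition rel_injective (I : gmodule A) : Prop :=
  forall (M1 M2 M3 : gmodule A) (d1 : M1 -> M2) (d2 : M2 -> M3),
    ghom d1 -> ghom d2 -> rel_short_exact d1 d2 ->
    forall f : M1 -> I, ghom f ->
      exists h : M2 -> I, ghom h /\ forall x, f x = h (d1 x).

Record rel_resolution (N : gmodule A) := RelResolution {
  rterm : nat -> gmodule A;
  raug : N -> rterm 0%N;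
  rdiff : forall i, rterm i -> rterm i.+1;
  raug_hom : ghom raug;
  rdiff_hom : forall i, ghom (@rdiff i);
  raug_inj : forall x, raug x = 0 -> x = 0;
  rexact0 : rel_exact_at raug (@rdiff 0);
  rexactS : forall i, rel_exact_at (@rdiff i) (@rdiff i.+1);
  rterm_inj : forall i, rel_injective (rterm i)
}.

End Relative.
End Modules.

Arguments rdiff {k G A C CA N} r i _.
Arguments rdiff_hom {k G A C CA N} r i.

Section SubQuotient.
Context (k : fieldType) (V : lmodType k).

Section Sub.
Context (W : V -> Prop) (sW : subspace W).

Definition subsp_pred of subspace W : {pred V} := fun x => `[< W x >].

Lemma subsp_predP x : reflect (W x) (x \in subsp_pred sW).
Proof. exact: asboolP. Qed.

Lemma subsp_closed : GRing.submod_closed (subsp_pred sW).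
Proof.
split=> [|c x y /subsp_predP Wx /subsp_predP Wy]; apply/subsp_predP.
  exact: sW.1.
exact: sW.2.
Qed.

HB.instance Definition _ :=
  GRing.isSubmodClosed.Build k V (subsp_pred sW) subsp_closed.

Record subsp := Subsp { subsp_val :> V; _ : subsp_val \in subsp_pred sW }.
HB.instance Definition _ := [isSub for subsp_val].
HB.instance Definition _ := [Choice of subsp by <:].
HB.instance Definition _ := [SubChoice_isSubLmodule of subsp by <:].

End Sub.

Context (Z B : V -> Prop) (sZ : subspace Z) (sB : subspace B).

Definition sq_equiv (x y : subsp sZ) : bool := `[< B (val x - val y) >].

Lemma subspN x : B x -> B (- x).
Proof.
by move=> Bx; have := sB.2 (-1) x 0 Bx sB.1; rewrite scaleN1r addr0.
Qed.
Lemma subspD x y : B x -> B y -> B (x + y).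
Proof. by move=> Bx By; have := sB.2 1 x y Bx By; rewrite scale1r. Qed.
Lemma subspZ c x : B x -> B (c *: x).
Proof. by move=> Bx; have := sB.2 c x 0 Bx sB.1; rewrite addr0. Qed.

Lemma sq_refl : reflexive sq_equiv.
Proof. by move=> x; apply/asboolP; rewrite subrr; exact: sB.1. Qed.
Lemma sq_sym : symmetric sq_equiv.
Proof.
by move=> x y; apply/asboolP/asboolP => /subspN; rewrite opprB.
Qed.
Lemma sq_trans : transitive sq_equiv.
Proof.
move=> y x z /asboolP h1 /asboolP h2; apply/asboolP.
by have := subspD h1 h2; rewrite addrA subrK.
Qed.

Canonical sq_equivR := EquivRel sq_equiv sq_refl sq_sym sq_trans.

Definition subquot : Type := let _ := sB in {eq_quot sq_equivR}.
HB.instance Definition _ := Choice.copy subquot {eq_quot sq_equivR}.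

Definition sq_class (x : subsp sZ) : subquot := \pi_({eq_quot sq_equivR}) x.
Definition sq_repr (x : subquot) : subsp sZ := repr (x : {eq_quot sq_equivR}).

Lemma sq_reprK : cancel sq_repr sq_class.
Proof. by move=> x; rewrite /sq_class /sq_repr reprK. Qed.

Lemma sq_classP x y : sq_class x = sq_class y <-> B (val x - val y).
Proof.
split=> [/eqmodP/asboolP //|h].
by apply/eqmodP/asboolP.
Qed.

Lemma sq_reprP x : B (val (sq_repr (sq_class x)) - val x).
Proof. by apply/sq_classP; rewrite sq_reprK. Qed.

Definition sq_add x y := sq_class (sq_repr x + sq_repr y).
Definition sq_opp x := sq_class (- sq_repr x).
Definition sq_scale c x := sq_class (c *: sq_repr x).

Lemma sq_addE x y : sq_add (sq_class x) (sq_class y) = sq_class (x + y).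
Proof.
apply/sq_classP; rewrite !raddfD /= addrACA.
by apply: subspD; apply: sq_reprP.
Qed.
Lemma sq_oppE x : sq_opp (sq_class x) = sq_class (- x).
Proof.
by apply/sq_classP; rewrite !raddfN /= -opprD; apply: subspN; apply: sq_reprP.
Qed.
Lemma sq_scaleE c x : sq_scale c (sq_class x) = sq_class (c *: x).
Proof.
apply/sq_classP; set r := sq_repr _.
have -> : val (c *: r) - val (c *: x) = c *: (val r - val x).
  by rewrite scalerBr.
exact/subspZ/sq_reprP.
Qed.

Lemma sq_addA : associative sq_add.
Proof.
move=> x y z; rewrite -[x]sq_reprK -[y]sq_reprK -[z]sq_reprK.
by rewrite !sq_addE addrA.
Qed.
Lemma sq_addC : commutative sq_add.
Proof. by move=> x y; rewrite /sq_add addrC. Qed.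
Lemma sq_add0 : left_id (sq_class 0) sq_add.
Proof. by move=> x; rewrite -[x]sq_reprK sq_addE add0r. Qed.
Lemma sq_addN : left_inverse (sq_class 0) sq_opp sq_add.
Proof. by move=> x; rewrite -[x]sq_reprK sq_oppE sq_addE addNr. Qed.
HB.instance Definition _ :=
  GRing.isZmodule.Build subquot sq_addA sq_addC sq_add0 sq_addN.

Lemma sq_scaleA a b x : sq_scale a (sq_scale b x) = sq_scale (a * b) x.
Proof. by rewrite -[x]sq_reprK !sq_scaleE scalerA. Qed.
Lemma sq_scale1 : left_id 1 sq_scale.
Proof. by move=> x; rewrite -[x]sq_reprK sq_scaleE scale1r. Qed.
Lemma sq_scaleDr : right_distributive sq_scale +%R.
Proof.
move=> a x y; rewrite -[x]sq_reprK -[y]sq_reprK.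
rewrite -[sq_class _ + sq_class _]/(sq_add _ _) sq_addE !sq_scaleE.
by rewrite -[sq_class _ + sq_class _]/(sq_add _ _) sq_addE scalerDr.
Qed.
Lemma sq_scaleDl x : {morph sq_scale^~ x : a b / a + b}.
Proof.
move=> a b; rewrite -[x]sq_reprK !sq_scaleE.
by rewrite -[sq_class _ + sq_class _]/(sq_add _ _) sq_addE scalerDl.
Qed.
HB.instance Definition _ := GRing.Zmodule_isLmodule.Build k subquot
  sq_scaleA sq_scale1 sq_scaleDr sq_scaleDl.

End SubQuotient.

Section Ext.
Context (k : fieldType) (G : algGroup k) (A C : closedSubgroup G)
  (CA : subgroup_le C A) (M N : gmodule A) (I : rel_resolution CA N).

(* The complex Hom_A(M, I_0) -> Hom_A(M, I_1) -> ..., its terms being subspaces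
   of the spaces of all functions from M to I_i. *)
Definition cocycle (i : nat) (f : M -> rterm I i) : Prop :=
  ghom f /\ forall x, rdiff I i (f x) = 0.

Definition coboundary (i : nat) : (M -> rterm I i) -> Prop :=
  match i with
  | 0%N => fun f => f = 0
  | j.+1 => fun f => exists g : M -> rterm I j,
      ghom g /\ f = (fun x => rdiff I j (g x))
  end.

Lemma lin_tmapl (U V : lmodType k) (R : comAlgType k) (x : U ⊗ R) (c : k)
    (f g : U -> V) :
  tmap (c *: f + g) id x = c *: tmap f id x + tmap g id x.
Proof.
have e u : (c *: f + g) u = c *: f u + g u by [].
rewrite /tmap /tlift /fsval scaler_sumr -big_split /=; apply: eq_bigr => p _.
by rewrite -(lin_tensl p.2 c (f p.1) (g p.1)).
Qed.

Lemma tmap0l (U V : lmodType k) (R : comAlgType k) (x : U ⊗ R) :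
  tmap (0 : U -> V) id x = 0.
Proof.
rewrite /tmap /tlift /fsval big1 // => p _.
exact: (lin0 (f := fun v => tens v p.2) (@lin_tensl _ _ _ _)).
Qed.

Lemma act_lin_k (H : closedSubgroup G) (P : gmodule H) (R : comAlgType k)
  (g : gpoint G R) : mem_point H g -> linear (@act k G H P R g).
Proof.
move=> Hg c x y; have sc z : tscale (c%:A : R) z = c *: z :> P ⊗ R.
  move: z; apply: tens_ext => [||m s]; [exact: lin_tscale|by lin|].
  by rewrite tscaleE -scalerAl mul1r (linZ _ _ (@lin_tensr _ _ _ m)).
by rewrite -!sc (act_lin Hg).
Qed.

Lemma ghom_subspace (H : closedSubgroup G) (P Q : gmodule H) :
  subspace (fun f : P -> Q => ghom f).
Proof.
split=> [|c f g [lf hf] [lg hg]].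
  split=> [a x y|R h Hh x]; first by rewrite /= scaler0 addr0.
  by rewrite !tmap0l (lin0 (act_lin_k Hh)).
split=> [a x y|R h Hh x].
  have e u : (c *: f + g) u = c *: f u + g u by [].
  by rewrite !e lf lg !scalerDr !scalerA mulrC addrACA.
by rewrite !lin_tmapl (act_lin_k Hh) hf ?hg.
Qed.

Lemma cocycle_subspace i : subspace (@cocycle i).
Proof.
split=> [|c f g [hf df] [hg dg]]; split=> [|x].
- exact: (ghom_subspace _ _).1.
- by rewrite (lin0 (rdiff_hom I i).1).
- exact: (ghom_subspace _ _).2.
- by rewrite -[(c *: f + g) x]/(c *: f x + g x) (rdiff_hom I i).1 df dg
             scaler0 addr0.
Qed.

Lemma coboundary_subspace i : subspace (@coboundary i).
Proof.
case: i => [|i].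
  by split=> [|c x y]; [|move=> -> ->; rewrite scaler0 addr0].
split=> [|c f g [f' [hf ->]] [g' [hg ->]]].
  exists 0; split; first exact: (ghom_subspace _ _).1.
  by apply/funext => x; rewrite (lin0 (rdiff_hom I i).1).
exists (c *: f' + g'); split; first exact: (ghom_subspace _ _).2.
by apply/funext => x; rewrite -[(c *: f' + g') x]/(c *: f' x + g' x)
  (rdiff_hom I i).1.
Qed.

Definition relExt (i : nat) : lmodType k :=
  subquot (cocycle_subspace i) (coboundary_subspace i).

End Ext.

Lemma functional_sep (k : fieldType) (V : lmodType k) (S : V -> Prop) (r : V) :
  subspace S -> ~ S r ->
  exists alpha : V -> k^o,
    [/\ linear alpha, forall x, S x -> alpha x = 0 & alpha r = 1].
Proof.
move=> sS nSr.
pose PP (X : set V) := subspace (X `|` S)%classic /\ ~ (X `|` S)%classic r.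
have [F FP Ftot|X [[sX nXr] Xmax]] := @Zorn_bigcup V PP.
  split; last first.
    move=> [[X FX Xr]|//]; have [_ nX] := FP _ FX; apply: nX; by left.
  split=> [|c x y]; first by right; exact: sS.1.
  move=> [[X FX Xx]|Sx] [[Y FY Yy]|Sy].
  - have [XY|YX] := Ftot _ _ FX FY.
      have [[_ h] _] := FP _ FY.
      have [|||] := h c x y; [by left; apply: XY|by left|move=> ?|by right].
      by left; exists Y.
    have [[_ h] _] := FP _ FX.
    have [|||] := h c x y; [by left|by left; apply: YX|move=> ?|by right].
    by left; exists X.
  - have [[_ h] _] := FP _ FX.
    have [|||] := h c x y; [by left|by right|move=> ?|by right].
    by left; exists X.
  - have [[_ h] _] := FP _ FY.
    have [|||] := h c x y; [by right|by left|move=> ?|by right].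
    by left; exists Y.
  - by right; apply: sS.2.
pose T := (X `|` S)%classic.
have dec x : exists c : k, T (x - c *: r).
  have [Tx|nTx] := pselect (T x); first by exists 0; rewrite scale0r subr0.
  pose Y : set V := fun y => exists t d, T t /\ y = t + d *: x.
  have TY : (T `<=` Y)%classic.
    by move=> t Tt; exists t, 0; rewrite scale0r addr0.
  have YS : (Y `|` S)%classic = Y.
    apply/seteqP; split=> y; last by left.
    by case=> // Sy; apply: TY; right.
  have XY : (X `<` Y)%classic.
    split; first by move=> y Xy; apply: TY; left.
    move=> YX; apply: nTx; left; apply: YX; exists 0, 1.
    by rewrite scale1r add0r; split=> //; exact: sX.1.
  have sY : subspace Y.
    split; first by apply: TY; exact: sX.1.
    move=> c _ _ [t [d [Tt ->]]] [t' [d' [Tt' ->]]].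
    exists (c *: t + t'), (c * d + d'); split; first exact: sX.2.
    by rewrite scalerDr scalerDl scalerA addrACA.
  have /not_andP[] := Xmax _ XY; rewrite YS // => /contrapT.
  move=> [t [d [Tt rE]]].
  have d0 : d != 0.
    by apply/negP => /eqP d0; apply: nXr; rewrite rE d0 scale0r addr0.
  exists d^-1; rewrite rE scalerDr scalerA mulVf // scale1r opprD addrCA subrr.
  by rewrite addr0 -scaleNr -[_ *: t]addr0; apply: sX.2 => //; exact: sX.1.
have TN x y c : T x -> T y -> T (c *: x + y) by exact: sX.2.
have uniq_c x c d : T (x - c *: r) -> T (x - d *: r) -> c = d.
  move=> h1 h2; apply/eqP; rewrite -subr_eq0; apply/negP => /negP cd.
  apply: nXr; have h := TN _ _ (-1) h1 h2.
  have {}h : T ((c - d) *: r).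
    by move: h; rewrite scaleN1r opprB addrA subrK -scalerBl.
  have := TN _ 0 (c - d)^-1 h sX.1.
  by rewrite scalerA mulVf // scale1r addr0.
pose alpha x : k^o := sval (cid (dec x)).
have aP x : T (x - alpha x *: r) by rewrite /alpha; case: cid.
exists alpha; split.
- move=> c x y; apply: (uniq_c (c *: x + y)); first exact: aP.
  have := TN _ _ c (aP x) (aP y).
  by rewrite scalerBr addrACA -opprD scalerA -scalerDl.
- move=> x Sx; apply: (uniq_c x); first exact: aP.
  by rewrite scale0r subr0; right.
- apply: (uniq_c r); first exact: aP.
  by rewrite scale1r subrr; exact: sX.1.
Qed.

Section Flatness.
Context (k : fieldType).
Implicit Types V R U : lmodType k.

Definition contract V R (alpha : R -> k^o) : V ⊗ R -> V :=
  tlift (fun v r => (alpha r : k) *: v).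

Lemma lin_contract V R (alpha : R -> k^o) :
  linear alpha -> linear (contract (V := V) alpha).
Proof. by move=> la; rewrite /contract; lin. Qed.

Lemma contractE V R (alpha : R -> k^o) (v : V) r : linear alpha ->
  contract alpha (tens v r) = (alpha r : k) *: v.
Proof. by move=> la; rewrite /contract; tE. Qed.

Lemma tens_sub_subspace V R (W : V -> Prop) : subspace W ->
  subspace (fun z : V ⊗ R => tens_sub W z).
Proof.
move=> sW; split=> [|c _ _ [s [hs ->]] [t [ht ->]]].
  by exists [::]; rewrite big_nil.
exists ([seq (c *: p.1, p.2) | p <- s] ++ t); split.
  move=> p; rewrite mem_cat => /orP[/mapP[q qs ->]|]; last exact: ht.
  exact/(subspZ sW)/hs.
rewrite big_cat big_map scaler_sumr; congr (_ + _); apply: eq_bigr => p _.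
by rewrite -(linZ _ _ (@lin_tensl _ _ _ p.2)).
Qed.

Lemma tens_sub_tens V R (W : V -> Prop) v (r : R) :
  W v -> tens_sub W (tens v r).
Proof.
move=> Wv; exists [:: (v, r)]; rewrite big_seq1; split=> // p.
by rewrite inE => /eqP ->.
Qed.

Lemma tens_sub_contract_ord V R (W : V -> Prop) n (v : 'I_n -> V) (r : 'I_n -> R) :
  subspace W ->
  (forall alpha : R -> k^o, linear alpha ->
     W (contract alpha (\sum_i tens (v i) (r i)))) ->
  tens_sub W (\sum_i tens (v i) (r i)).
Proof.
move=> sW; elim: n v r => [|n IH] v r h.
  by rewrite big_ord0; exact: (tens_sub_subspace _ sW).1.
pose S x := exists c : 'I_n -> k, x = \sum_i c i *: r (lift ord0 i).
have sS : subspace S.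
  split; first by exists (fun=> 0); rewrite big1 // => i _; rewrite scale0r.
  move=> c _ _ [d ->] [e ->]; exists (fun i => c * d i + e i).
  rewrite scaler_sumr -big_split; apply: eq_bigr => i _.
  by rewrite scalerDl scalerA.
have [[c rE]|nS] := pselect (S (r ord0)).
  have zE : \sum_i tens (v i) (r i) =
      \sum_i tens (v (lift ord0 i) + c i *: v ord0) (r (lift ord0 i)).
    rewrite big_ord_recl rE (lin_sum _ _ (@lin_tensr _ _ _ _)) -big_split.
    apply: eq_bigr => i _ /=.
    rewrite (linD _ _ (@lin_tensl _ _ _ _)) (linZ _ _ (@lin_tensl _ _ _ _)).
    by rewrite (linZ _ _ (@lin_tensr _ _ _ _)) addrC.
  by rewrite zE; apply: IH => alpha la; rewrite -zE; apply: h.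
have [alpha [la aS ar]] := functional_sep sS nS.
have Wv : W (v ord0).
  have := h _ la; rewrite (lin_sum _ _ (lin_contract la)) big_ord_recl.
  rewrite contractE // ar scale1r big1 ?addr0 // => i _.
  rewrite contractE // aS ?scale0r //.
  exists (fun j => (j == i)%:R); rewrite (bigD1 i) //= eqxx scale1r.
  by rewrite big1 ?addr0 // => j /negbTE ->; rewrite scale0r.
rewrite big_ord_recl; apply: (subspD (tens_sub_subspace _ sW)).
  exact: tens_sub_tens.
apply: IH => beta lb.
have := h _ lb; rewrite big_ord_recl (linD _ _ (lin_contract lb)) contractE //.
move=> hb; have := sW.2 (- beta (r ord0)) _ _ Wv hb.
by rewrite addrA scaleNr addNr add0r.
Qed.

Lemma tens_sub_contract V R (W : V -> Prop) (z : V ⊗ R) : subspace W ->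
  (forall alpha : R -> k^o, linear alpha -> W (contract alpha z)) ->
  tens_sub W z.
Proof.
move=> sW; rewrite (tens_sum z) (big_nth (0, 0)) big_mkord => h.
by apply: (tens_sub_contract_ord sW).
Qed.

Lemma tens_contract0 V R (z : V ⊗ R) :
  (forall alpha : R -> k^o, linear alpha -> contract alpha z = 0) -> z = 0.
Proof.
move=> h; have sW : subspace (fun v : V => v = 0).
  by split=> // c x y -> ->; rewrite scaler0 addr0.
have [s [hs ->]] := tens_sub_contract sW h.
rewrite big_seq big1 // => p /hs ->.
exact: (lin0 (@lin_tensl _ _ _ _)).
Qed.

Lemma tmap_contract V U R (f : V -> U) (alpha : R -> k^o) (z : V ⊗ R) :
  linear f -> linear alpha -> contract alpha (tmap f id z) = f (contract alpha z).
Proof.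
move=> lf la; move: z; apply: tens_ext => [||v r].
- by apply: (lin_comp (lin_contract la)); exact: lin_tmap.
- by apply: (lin_comp lf); exact: lin_contract.
- by rewrite tmapE // !contractE // linZ.
Qed.

Lemma tmap_inj V U R (f : V -> U) : linear f -> injective f ->
  injective (tmap f id : V ⊗ R -> U ⊗ R).
Proof.
move=> lf injf x y exy; apply/eqP; rewrite -subr_eq0; apply/eqP.
apply: tens_contract0 => alpha la; apply: injf.
have lt : linear (tmap f id : V ⊗ R -> U ⊗ R) by exact: lin_tmap.
rewrite -tmap_contract // (lin0 lf) addrC -scaleN1r lt scaleN1r exy addNr.
by rewrite (lin0 (lin_contract la)).
Qed.

End Flatness.

Section Induction.
Context (k : fieldType) (G : algGroup k) (H : closedSubgroup G) (N : gmodule H).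

(* Right and left regular translation of functions on G by u in G(R):
   a |-> (x |-> a (x u)), resp. a |-> (x |-> a (u x)). *)
Definition rtrans (R : comAlgType k) (u : gpoint G R) (a : G) : G ⊗ R :=
  tlift (fun a1 a2 => tens a1 (u a2)) (comul G a).

Definition ltrans (R : comAlgType k) (u : gpoint G R) (a : G) : G ⊗ R :=
  tlift (fun a1 a2 => tens a2 (u a1)) (comul G a).

(* (M ⊗ R) ⊗_R (M' ⊗ R) -> (M ⊗ M') ⊗ R *)
Definition tcomb (M M' : lmodType k) (R : comAlgType k) (x : M ⊗ R)
    (y : M' ⊗ R) : (M ⊗ M') ⊗ R :=
  tlift (fun m r => tlift (fun m' s => tens (tens m m') (r * s)) y) x.

(* The action of h in H(R) on f ⊗ 1 for f in N ⊗ k[G], where H acts as given on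
   N and by right translation on k[G]. *)
Definition ind_hact (R : comAlgType k) (h : gpoint G R) (f : N ⊗ G) :
    (N ⊗ G) ⊗ R :=
  tlift (fun n a => tcomb (act h (tens n 1)) (rtrans h a)) f.

(* (N ⊗ k[G])^H *)
Definition ind_inv (f : N ⊗ G) : Prop :=
  forall (R : comAlgType k) (h : gpoint G R), mem_point H h ->
    ind_hact h f = tens f 1.

Lemma lin_act_tens1 (R : comAlgType k) (h : gpoint G R) : mem_point H h ->
  linear (fun n : N => act h (tens n 1)).
Proof.
move=> Hh; apply: (lin_comp (g := @act k G H N R h)); first exact: act_lin_k.
by lin.
Qed.

Lemma lin_tcombl (M M' : lmodType k) (R : comAlgType k) (y : M' ⊗ R) :
  linear (fun x : M ⊗ R => tcomb x y).
Proof. by rewrite /tcomb; lin. Qed.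

Lemma lin_tcombr (M M' : lmodType k) (R : comAlgType k) (x : M ⊗ R) :
  linear (fun y : M' ⊗ R => tcomb x y).
Proof. by rewrite /tcomb; lin. Qed.

Lemma lin_rtrans (R : comAlgType k) (h : gpoint G R) : linear (rtrans h).
Proof. by rewrite /rtrans; lin. Qed.

Lemma lin_ltrans (R : comAlgType k) (h : gpoint G R) : linear (ltrans h).
Proof. by rewrite /ltrans; lin. Qed.

Lemma bilin_ind_hact (R : comAlgType k) (h : gpoint G R) : mem_point H h ->
  bilin (fun (n : N) (a : G) => tcomb (act h (tens n 1)) (rtrans h a)).
Proof.
move=> Hh; split=> [a|n].
  apply: (lin_comp (g := fun x => tcomb x (rtrans h a))).
    exact: lin_tcombl.
  exact: lin_act_tens1.
apply: (lin_comp (g := fun y => tcomb (act h (tens n 1)) y)).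
  exact: lin_tcombr.
exact: lin_rtrans.
Qed.

Lemma lin_ind_hact (R : comAlgType k) (h : gpoint G R) : mem_point H h ->
  linear (ind_hact h).
Proof. by move=> Hh; apply/linear_tlift/bilin_ind_hact. Qed.

Lemma ind_inv_subspace : subspace ind_inv.
Proof.
split=> [R h Hh|c x y ix iy R h Hh].
  by rewrite (lin0 (lin_ind_hact Hh)) (lin0 (@lin_tensl _ _ _ _)).
by rewrite (lin_ind_hact Hh) ix // iy // -(@lin_tensl _ _ _ 1).
Qed.

(* Left translation on (N ⊗ k[G]) ⊗ R, R-linear, trivial on N. *)
Definition ind_ltrans (R : comAlgType k) (u : gpoint G R)
    (z : (N ⊗ G) ⊗ R) : (N ⊗ G) ⊗ R :=
  tlift (fun f r =>
    tscale r (tlift (fun n a =>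
      tlift (fun a' s => tens (tens n a') s) (ltrans u a)) f)) z.

Lemma bilin_ltrans_aux (R : comAlgType k) (u : gpoint G R) : bilin
  (fun (n : N) a => tlift (fun a' s => tens (tens n a') s) (ltrans u a)).
Proof.
split=> [a|n]; first by lin.
apply: (lin_comp (g := tlift _)); last exact: lin_ltrans.
by lin.
Qed.

Lemma bilin_ind_ltrans (R : comAlgType k) (u : gpoint G R) : bilin
  (fun (f : N ⊗ G) (r : R) =>
    tscale r (tlift (fun n a =>
      tlift (fun a' s => tens (tens n a') s) (ltrans u a)) f)).
Proof.
split=> [r|f]; last exact: lin_tscalel.
apply: (lin_comp (g := tscale r)); first exact: lin_tscale.
exact/linear_tlift/bilin_ltrans_aux.
Qed.

Lemma lin_ind_ltrans (R : comAlgType k) (u : gpoint G R) :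
  linear (ind_ltrans u).
Proof. exact/linear_tlift/bilin_ind_ltrans. Qed.

Lemma ind_ltransE (R : comAlgType k) (u : gpoint G R) (n : N) (a : G) (r : R) :
  ind_ltrans u (tens (tens n a) r) =
  tlift (fun a1 a2 => tens (tens n a2) (r * u a1)) (comul G a).
Proof.
rewrite /ind_ltrans tliftE; last exact: bilin_ind_ltrans.
rewrite tliftE; last exact: bilin_ltrans_aux.
rewrite /ltrans; move: (comul G a); apply: tens_ext => [||b c].
- apply: (lin_comp (g := tscale r)); first exact: lin_tscale.
  by lin.
- by lin.
- by tE; tE; tE; rewrite tscaleE.
Qed.

Lemma tens3_ext (U V W P : lmodType k) (f g : (U ⊗ V) ⊗ W -> P) :
  linear f -> linear g ->
  (forall u v w, f (tens (tens u v) w) = g (tens (tens u v) w)) -> f =1 g.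
Proof.
move=> lf lg h; apply: tens_ext => // x w.
move: x.
apply: (tens_ext (f := fun x => f (tens x w)) (g := fun x => g (tens x w)));
  last by move=> u v; exact: h.
  by apply: (lin_comp lf); lin.
by apply: (lin_comp lg); lin.
Qed.

Lemma tscaleA (M : lmodType k) (R : comAlgType k) (r s : R) (x : M ⊗ R) :
  tscale r (tscale s x) = tscale (r * s) x.
Proof.
move: x; apply: tens_ext => [||m t].
- by apply: lin_comp; exact: lin_tscale.
- exact: lin_tscale.
- by rewrite !tscaleE mulrA.
Qed.

Lemma ind_ltrans_tscale (R : comAlgType k) (u : gpoint G R) (r : R) z :
  ind_ltrans u (tscale r z) = tscale r (ind_ltrans u z).
Proof.
move: z; apply: tens_ext => [||f s].
- by apply: lin_comp; [exact: lin_ind_ltrans|exact: lin_tscale].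
- by apply: lin_comp; [exact: lin_tscale|exact: lin_ind_ltrans].
- rewrite tscaleE /ind_ltrans !tliftE; try exact: bilin_ind_ltrans.
  by rewrite tscaleA.
Qed.

Lemma eq_tlift (U V P : lmodType k) (f g : U -> V -> P) z :
  (forall u v, f u v = g u v) -> tlift f z = tlift g z.
Proof. by move=> e; rewrite /tlift /fsval; apply: eq_bigr => p _. Qed.

Lemma eq_ind_ltrans (R : comAlgType k) (u u' : gpoint G R) z :
  u =1 u' -> ind_ltrans u z = ind_ltrans u' z.
Proof.
move=> e; rewrite /ind_ltrans; apply: eq_tlift => f r; congr tscale.
apply: eq_tlift => n a; congr tlift; rewrite /ltrans.
by apply: eq_tlift => a1 a2; rewrite e.
Qed.

Lemma ind_ltrans1 (R : comAlgType k) z : ind_ltrans (gone G R) z = z.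
Proof.
move: z; apply: tens3_ext => [||n a r]; [exact: lin_ind_ltrans|by lin|].
rewrite ind_ltransE -[in RHS](counitl a); move: (comul G a).
apply: tens_ext => [||b c]; [by lin|by lin|].
tE; tE; rewrite /= /gone_fun -scalerAr mulr1.
rewrite (linZ _ _ (@lin_tensr _ _ _ n)) (linZ _ _ (@lin_tensl _ _ _ r)).
exact: (linZ _ _ (@lin_tensr _ _ _ _)).
Qed.

Lemma ind_ltransM (R : comAlgType k) (u v : gpoint G R) z :
  ind_ltrans u (ind_ltrans v z) = ind_ltrans (gmul v u) z.
Proof.
move: z; apply: tens3_ext => [||n a r].
- by apply: lin_comp; exact: lin_ind_ltrans.
- exact: lin_ind_ltrans.
rewrite !ind_ltransE.
pose F (x : G ⊗ (G ⊗ G)) : (N ⊗ G) ⊗ R :=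
  tlift (fun a1 y => tlift (fun a2 a3 =>
    tens (tens n a3) (r * (v a1 * u a2))) y) x.
have lF : linear F by rewrite /F; lin.
transitivity (F (tmap id (comul G) (comul G a))).
  move: (comul G a); apply: tens_ext => [||b c].
  - by apply: lin_comp; [exact: lin_ind_ltrans|lin].
  - by rewrite /F; lin.
  - rewrite tmapE //; last exact: linearP.
    rewrite /F; tE; tE; rewrite ind_ltransE; apply: eq_tlift => a2 a3.
    by rewrite mulrA.
rewrite -coassoc; move: (comul G a); apply: tens_ext => [||b c].
- by rewrite /F; lin.
- by rewrite /= /gmul_fun; lin.
rewrite tmapE //; last exact: linearP.
tE; rewrite /= /gmul_fun /F; move: (comul G b).
apply: tens_ext => [||d e]; [by lin|by lin|].
by rewrite tassocE; tE; tE; tE.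
Qed.

Lemma ind_ltrans_nat (R S : comAlgType k) (phi : {lrmorphism R -> S})
    (u : gpoint G R) (u' : gpoint G S) z : (forall a, u' a = phi (u a)) ->
  tmap id phi (ind_ltrans u z) = ind_ltrans u' (tmap id phi z).
Proof.
move=> e; have lp : linear (tmap id phi : (N ⊗ G) ⊗ R -> (N ⊗ G) ⊗ S).
  by apply: lin_tmap; last exact: linearP.
move: z; apply: tens3_ext => [||n a r].
- by apply: lin_comp; [exact: lp|exact: lin_ind_ltrans].
- by apply: lin_comp; [exact: lin_ind_ltrans|exact: lp].
have lphi : linear phi by exact: linearP.
rewrite tmapE // !ind_ltransE; move: (comul G a); apply: tens_ext => [||b c].
- by apply: lin_comp; [exact: lp|lin].
- by lin.
by tE; tE; rewrite tmapE // e rmorphM.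
Qed.

Lemma ind_inv_stable (lam : G -> G) (f : N ⊗ G) : linear lam ->
  (forall a, comul G (lam a) = tmap lam id (comul G a)) ->
  ind_inv f -> ind_inv (tmap id lam f).
Proof.
move=> ll lc If R h Hh.
have l1 : linear (tmap id lam : N ⊗ G -> N ⊗ G) by apply: lin_tmap.
have l2 : linear (tmap (tmap id lam) id : (N ⊗ G) ⊗ R -> (N ⊗ G) ⊗ R).
  by apply: lin_tmap.
transitivity (tmap (tmap id lam) id (ind_hact h f)); last first.
  by rewrite If // tmapE.
move: f {If}; apply: tens_ext => [||n a].
- by apply: lin_comp; [exact: lin_ind_hact|exact: l1].
- by apply: lin_comp; [exact: l2|exact: lin_ind_hact].
rewrite tmapE // /ind_hact !tliftE; try exact: bilin_ind_hact.
rewrite /rtrans lc; move: (act h (tens n 1)) => x.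
move: (comul G a); apply: tens_ext => [||b c].
- apply: (lin_comp (g := fun y => tcomb x y)); first exact: lin_tcombr.
  by lin.
- apply: (lin_comp (f := fun y => tcomb x _)); first exact: l2.
  apply: (lin_comp (g := fun y => tcomb x y)); first exact: lin_tcombr.
  by lin.
rewrite tmapE //; tE; tE; move: x; apply: tens_ext => [||m r].
- exact: lin_tcombl.
- by apply: (lin_comp (f := fun x => tcomb x _)); [exact: l2|exact: lin_tcombl].
- by rewrite /tcomb; do 4!tE; rewrite !tmapE.
Qed.

Lemma ind_ltrans_sub (R : comAlgType k) (u : gpoint G R) (z : (N ⊗ G) ⊗ R) :
  tens_sub ind_inv z -> tens_sub ind_inv (ind_ltrans u z).
Proof.
move=> [s [hs ->]]; apply: (tens_sub_contract ind_inv_subspace) => alpha la.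
have lL := lin_ind_ltrans u; have lC := lin_contract (V := N ⊗ G) la.
rewrite (lin_sum _ _ lL) (lin_sum _ _ lC).
have big_ind_inv (t : seq ((N ⊗ G) * R)) (F : (N ⊗ G) * R -> N ⊗ G) :
    (forall p, p \in t -> ind_inv (F p)) -> ind_inv (\sum_(p <- t) F p).
  elim: t => [|p t IH] ht; first by rewrite big_nil; exact: ind_inv_subspace.1.
  rewrite big_cons; apply: (subspD ind_inv_subspace).
    by apply: ht; rewrite mem_head.
  by apply: IH => q qt; apply: ht; rewrite in_cons qt orbT.
apply: big_ind_inv => -[f r] /hs /= If.
pose lam a := tlift (fun a1 a2 => (alpha (r * u a1) : k) *: a2) (comul G a).
have ll : linear lam by rewrite /lam; lin.
have -> : contract alpha (ind_ltrans u (tens f r)) = tmap id lam f.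
  move: f {If}; apply: tens_ext => [||n a].
  - by apply: (lin_comp lC); apply: (lin_comp lL); lin.
  - exact: lin_tmap.
  rewrite tmapE // ind_ltransE /lam; move: (comul G a).
  apply: tens_ext => [||b c].
  - by apply: (lin_comp lC); lin.
  - by lin.
  tE; tE; rewrite contractE //.
  by rewrite (linZ _ _ (@lin_tensr _ _ _ n)).
apply: ind_inv_stable => // a.
pose F (x : G ⊗ (G ⊗ G)) : G ⊗ G :=
  tlift (fun a1 y => (alpha (r * u a1) : k) *: y) x.
have lF : linear F by rewrite /F; lin.
transitivity (F (tmap id (comul G) (comul G a))).
  rewrite /lam /F; move: (comul G a); apply: tens_ext => [||b c]; [by lin|by lin|].
  rewrite tmapE //; last exact: linearP.
  by tE; tE; rewrite linearZ.
rewrite -coassoc; move: (comul G a); apply: tens_ext => [||b c].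
- by rewrite /F; lin.
- by apply: lin_tmap.
rewrite !tmapE //; last exact: linearP.
rewrite /lam /F; move: (comul G b); apply: tens_ext => [||d e]; [by lin|by lin|].
rewrite tassocE; tE; tE.
by rewrite (linZ _ _ (@lin_tensl _ _ _ c)).
Qed.

Definition ind_car : lmodType k := subsp ind_inv_subspace.

Definition ind_incl (R : comAlgType k) : ind_car ⊗ R -> (N ⊗ G) ⊗ R :=
  tmap (fun f : ind_car => val f) id.

Lemma lin_val : linear (fun f : ind_car => val f : N ⊗ G).
Proof. by []. Qed.

Lemma lin_ind_incl (R : comAlgType k) : linear (@ind_incl R).
Proof. by apply: lin_tmap; first exact: lin_val. Qed.

Lemma ind_incl_inj (R : comAlgType k) : injective (@ind_incl R).
Proof. by apply: tmap_inj; [exact: lin_val|exact: val_inj]. Qed.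

Lemma ind_incl_sub (R : comAlgType k) (x : ind_car ⊗ R) :
  tens_sub ind_inv (ind_incl x).
Proof.
exists [seq (val p.1, p.2) | p <- tens_repr x]; split.
  by move=> _ /mapP[[[f fI] r] _ ->]; apply/(subsp_predP ind_inv_subspace).
by rewrite big_map.
Qed.

Lemma ind_inclP (R : comAlgType k) (z : (N ⊗ G) ⊗ R) :
  tens_sub ind_inv z -> exists x, ind_incl x = z.
Proof.
move=> [s [hs ->]]; elim: s hs => [|p s IH] hs.
  by exists 0; rewrite big_nil (lin0 (@lin_ind_incl R)).
have [|x xE] := IH; first by move=> q qs; apply: hs; rewrite in_cons qs orbT.
have /subsp_predP Ip : ind_inv p.1 by apply: hs; rewrite mem_head.
exists (tens (Subsp (Ip ind_inv_subspace) : ind_car) p.2 + x).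
rewrite (linD _ _ (@lin_ind_incl R)) xE big_cons; congr (_ + _).
by rewrite /ind_incl tmapE //; exact: lin_val.
Qed.

Lemma ind_act_ex (R : comAlgType k) (g : gpoint G R) (x : ind_car ⊗ R) :
  exists y : ind_car ⊗ R, ind_incl y = ind_ltrans (ginv g) (ind_incl x).
Proof. exact/ind_inclP/ind_ltrans_sub/ind_incl_sub. Qed.

(* g acts by (g f)(x) = f (g^-1 x). *)
Definition ind_act (R : comAlgType k) (g : gpoint G R) (x : ind_car ⊗ R) :
  ind_car ⊗ R := sval (cid (ind_act_ex g x)).

Lemma ind_actP (R : comAlgType k) (g : gpoint G R) (x : ind_car ⊗ R) :
  ind_incl (ind_act g x) = ind_ltrans (ginv g) (ind_incl x).
Proof. by rewrite /ind_act; case: cid. Qed.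

Lemma ind_incl_tscale (R : comAlgType k) (r : R) x :
  ind_incl (tscale r x) = tscale r (ind_incl x).
Proof. by apply: tmap_tscale; exact: lin_val. Qed.

Lemma ind_incl_nat (R S : comAlgType k) (phi : {lrmorphism R -> S}) x :
  tmap id phi (@ind_incl R x) = @ind_incl S (tmap id phi x).
Proof.
have lphi : linear phi by exact: linearP.
move: x; apply: tens_ext => [||f r].
- by apply: lin_comp; [exact: lin_tmap|exact: lin_ind_incl].
- by apply: lin_comp; [exact: lin_ind_incl|exact: lin_tmap].
- by rewrite /ind_incl !tmapE //; exact: lin_val.
Qed.

Definition ind : gmodule (fullG G).
Proof.
refine (@GModule k G (fullG G) ind_car ind_act _ _ _ _).
- move=> R g _ r x y; apply: ind_incl_inj.
  rewrite ind_actP !(linD _ _ (@lin_ind_incl R)) !ind_incl_tscale !ind_actP.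
  by rewrite (linD _ _ (lin_ind_ltrans _)) ind_ltrans_tscale.
- move=> R x; apply: ind_incl_inj; rewrite ind_actP.
  by rewrite (eq_ind_ltrans _ (@ginv1 k G R)) ind_ltrans1.
- move=> R g h _ _ x; apply: ind_incl_inj; rewrite !ind_actP ind_ltransM.
  by apply: eq_ind_ltrans; exact: ginvM.
- move=> R S phi g g' _ e x; apply: ind_incl_inj.
  rewrite -ind_incl_nat !ind_actP -ind_incl_nat.
  by apply: ind_ltrans_nat => a; rewrite /= e.
Defined.

End Induction.

(* Main.v *)
From HB Require Import structures.
Require Import Defs.
From mathcomp Require Import all_boot all_algebra.
From mathcomp Require Import boolp classical_sets functions.

(* Induction carries an (H, H ∩ K)-injective resolution of N to a
   (G, K)-injective resolution of ind N, and Frobenius reciprocity identifies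
   Hom_G(M, ind I) with Hom_H(M, I); so both Ext groups are computed by the same
   complex, and it remains to compare two resolutions of ind N.
   Injectivity of ind I follows from Frobenius reciprocity, because a K-split
   sequence is (H ∩ K)-split. For the splitting over K, note that a kernel is a
   summand if and only if the differential d has an equivariant quasi-inverse t,
   d t d = d. If HK = G, every (H ∩ K)-equivariant map s between H-modules
   induces a K-equivariant map of induced modules by
   (ind s)(f)(y l) = l^-1 s(f(y)), y in K, l in H, which is meaningful by
   faithfully flat descent; this turns quasi-inverses into quasi-inverses. If
   Mod(H) is semisimple, quasi-inverses exist over H = H ∩ G, and the same
   argument applies with G in place of K. *)

Set Implicit Arguments.
Unset Strict Implicit.
Unset Printing Implicit Defensive.

Import GRing.Theory.
Local Open Scope ring_scope.

(** * Tensor products of algebras *)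

(** The obstacle is that [ind] is not exact in general, while the splittings t are only (H ∩
    K)-equivariant, so that the functoriality of [ind] for H-maps does not reach them. Identities d
    t d = d are equations between maps and can be checked value by value after induction. A
    quasi-inverse exists only if both the kernel and the image of d are summands; in a resolution
    this is automatic, because the image is the next kernel. As k[G] may be non-reduced, values are
    taken at points over all k-algebras. The identity of k[G], the generic point, evaluates a
    function to itself, so a single flat cover, the one over which the generic point factors,
    suffices for the descent. The overlaps are algebras S ⊗_{k[G]} R, which must first be shown to
    be nonzero. *)

Section TensorProductAlgebra.
Context (R : comNzRingType) (A B : comAlgType R).

(** The ring structures in use exclude the zero ring, so the proof that 1 ⊗ 1 is nonzero is a
    parameter of the type. *)
Definition tens_alg (nz : tens 1 1 != 0 :> A ⊗ B) : Type := A ⊗ B.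

Context (nz : tens 1 1 != 0 :> A ⊗ B).
Local Notation T := (tens_alg nz).

HB.instance Definition _ := GRing.Lmodule.on T.

Definition talg_mul (x y : T) : T :=
  tlift (fun a b => tlift (fun c d => tens (a * c) (b * d)) y) x.

Lemma lin_talg_mull (y : T) : linear (fun x : T => talg_mul x y).
Proof. by rewrite /talg_mul; lin. Qed.

Lemma lin_talg_mulr (x : T) : linear (talg_mul x).
Proof. by rewrite /talg_mul; lin. Qed.

Lemma talg_mulE a b c d :
  talg_mul (tens a b) (tens c d) = tens (a * c) (b * d) :> T.
Proof. by rewrite /talg_mul; tE; tE. Qed.

Lemma talg_mulC : commutative talg_mul.
Proof.
move=> x y.
apply: (tens_ext (f := fun x : T => talg_mul x y)) => [||a b].
- exact: lin_talg_mull.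
- exact: lin_talg_mulr.
apply: (tens_ext (f := fun y : T => talg_mul (tens a b) y)
  (g := fun y : T => talg_mul y _)) => [||c d].
- exact: lin_talg_mulr.
- exact: lin_talg_mull.
by rewrite !talg_mulE mulrC [d * b]mulrC.
Qed.

Lemma talg_mulA : associative talg_mul.
Proof.
move=> x y z.
apply: (tens_ext (f := fun x : T => talg_mul x (talg_mul y z))
  (g := fun x : T => talg_mul (talg_mul x y) z)) => [||a b].
- exact: lin_talg_mull.
- by apply: (lin_comp (g := fun x : T => talg_mul x z)); exact: lin_talg_mull.
apply: (tens_ext (f := fun y : T => talg_mul (tens a b) (talg_mul y z))
  (g := fun y : T => talg_mul (talg_mul (tens a b) y) z)) => [||c d].
- apply: (lin_comp (g := talg_mul _)); first exact: lin_talg_mulr.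
  exact: lin_talg_mull.
- apply: (lin_comp (g := fun x : T => talg_mul x z)).
    exact: lin_talg_mull.
  exact: lin_talg_mulr.
apply: (tens_ext (f := fun z : T => talg_mul (tens a b) (talg_mul (tens c d) z))
  (g := fun z : T => talg_mul (talg_mul (tens a b) (tens c d)) z)) => [||e f].
- by apply: (lin_comp (g := talg_mul _)); exact: lin_talg_mulr.
- exact: lin_talg_mulr.
by rewrite !talg_mulE !mulrA.
Qed.

Lemma talg_mul1 : left_id (tens 1 1 : T) talg_mul.
Proof.
move=> x; apply: (tens_ext (f := talg_mul _) (g := fun x : T => x)) => [||a b].
- exact: lin_talg_mulr.
- exact: lin_id.
by rewrite talg_mulE !mul1r.
Qed.

Lemma talg_mulDl : left_distributive talg_mul +%R.
Proof. by move=> x y z; exact: (linD _ _ (lin_talg_mull z)). Qed.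

HB.instance Definition _ := GRing.Zmodule_isComNzRing.Build T
  talg_mulA talg_mulC talg_mul1 talg_mulDl nz.

Lemma talg_scaleAl (c : R) (x y : T) : c *: (x * y) = (c *: x) * y.
Proof. by rewrite -[RHS]/(talg_mul _ _) (linZ _ _ (lin_talg_mull y)). Qed.

HB.instance Definition _ := GRing.Lmodule_isLalgebra.Build R T talg_scaleAl.
HB.instance Definition _ := GRing.Lalgebra_isComAlgebra.Build R T.

Definition talg_inl (a : A) : T := tens a 1.
Definition talg_inr (b : B) : T := tens 1 b.

Lemma talg_inl_linear : linear talg_inl. Proof. exact: lin_tensl. Qed.
Lemma talg_inr_linear : linear talg_inr. Proof. exact: lin_tensr. Qed.

Lemma talg_inl_monoid : monoid_morphism talg_inl.
Proof.
by split=> // a b; rewrite -[RHS]/(talg_mul _ _) talg_mulE mulr1.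
Qed.
Lemma talg_inr_monoid : monoid_morphism talg_inr.
Proof.
by split=> // a b; rewrite -[RHS]/(talg_mul _ _) talg_mulE mulr1.
Qed.

HB.instance Definition _ :=
  GRing.isLinear.Build R A T *:%R talg_inl talg_inl_linear.
HB.instance Definition _ :=
  GRing.isLinear.Build R B T *:%R talg_inr talg_inr_linear.
HB.instance Definition _ :=
  GRing.isMonoidMorphism.Build A T talg_inl talg_inl_monoid.
HB.instance Definition _ :=
  GRing.isMonoidMorphism.Build B T talg_inr talg_inr_monoid.

End TensorProductAlgebra.

(** * Restriction of scalars and faithfully flat descent *)

Section RestrictScalarsAlgebra.
Context (R S : comNzRingType) (phi : {rmorphism R -> S}).

HB.instance Definition _ := GRing.ComNzRing.copy (rscal phi) S.

Lemma rscal_scaleAl (c : R) (x y : rscal phi) : c *: (x * y) = (c *: x) * y.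
Proof. exact: (mulrA (phi c) (x : S) (y : S)). Qed.

HB.instance Definition _ :=
  GRing.Lmodule_isLalgebra.Build R (rscal phi) rscal_scaleAl.
HB.instance Definition _ := GRing.Lalgebra_isComAlgebra.Build R (rscal phi).

End RestrictScalarsAlgebra.

Section FaithfulFlatness.
Context (A S : comNzRingType) (phi : {rmorphism A -> S}).
Hypothesis ff : faithfully_flat phi.

Lemma ff_exact (U V W : lmodType A) (u : U -> V) (v : V -> W) :
  linear u -> linear v ->
  exact_pair (tmap u id : U ⊗ rscal phi -> V ⊗ rscal phi)
             (tmap v id : V ⊗ rscal phi -> W ⊗ rscal phi) ->
  exact_pair u v.
Proof.
move=> lu lv.
pose u' : {linear U -> V} := HB.pack u (GRing.isLinear.Build _ _ _ _ u lu).
pose v' : {linear V -> W} := HB.pack v (GRing.isLinear.Build _ _ _ _ v lv).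
exact: (ff u' v').2.
Qed.

(* After tensoring with S the map w |-> 1 ⊗ w acquires the retraction
   (a ⊗ w) ⊗ b |-> w ⊗ (a b). *)
Lemma ff_tens1_inj (W : lmodType A) :
  injective (fun w : W => tens (1 : rscal phi) w).
Proof.
pose v w : rscal phi ⊗ W := tens 1 w.
have lv : linear v by exact: lin_tensr.
have l0 : linear (fun _ : W => 0 : W).
  by move=> c x y; rewrite scaler0 addr0.
suff ex : exact_pair (fun _ : W => 0 : W) v.
  move=> x y exy; have /ex[_ /esym/eqP] : v (x - y) = 0.
    by rewrite -scaleN1r addrC lv scaleN1r /v exy addNr.
  by rewrite subr_eq0 => /eqP.
apply: ff_exact => // z; split; last first.
  move=> [x <-]; move: x; apply: tens_ext => [||w s].
  - by apply: lin_comp; exact: lin_tmap.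
  - by move=> c x y; rewrite scaler0 addr0.
  by rewrite !tmapE // (lin0 lv) (lin0 (@lin_tensl _ _ _ s)).
pose m : (rscal phi ⊗ W) ⊗ rscal phi -> W ⊗ rscal phi :=
  tlift (fun x b => tlift (fun a w => tens w (a * b)) x).
have lm : linear m by rewrite /m; lin.
have mK : m (tmap v id z) = z.
  move: z; apply: tens_ext => [||w s].
  - by apply: (lin_comp lm); exact: lin_tmap.
  - exact: lin_id.
  by rewrite tmapE // /m; tE; tE; rewrite mul1r.
move=> z0; exists 0.
by rewrite -mK z0 (lin0 lm) (lin0 (lin_tmap l0 (@lin_id _ _))).
Qed.

Lemma ff_inj : injective phi.
Proof.
move=> a b ab; apply: (@ff_tens1_inj A^o) => /=.
have e (c : A) :
    tens (1 : rscal phi) (c : A^o) = tens (phi c : rscal phi) (1 : A^o).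
  rewrite -[c in LHS]mulr1 (linZ c (1 : A^o) (@lin_tensr _ _ _ _)).
  by rewrite -(linZ _ _ (@lin_tensl _ _ _ _)) -[c *: _]/(phi c * 1) mulr1.
by rewrite !e ab.
Qed.

(* The Amitsur complex A -> S -> S ⊗ S is exact: it is contracted by
   (a ⊗ b) ⊗ c |-> a ⊗ (b c) after tensoring with S. *)
Lemma ff_descent (s : rscal phi) :
  tens s 1 = tens 1 s :> rscal phi ⊗ rscal phi -> exists a, phi a = s.
Proof.
pose u (a : A^o) : rscal phi := phi a.
pose v (s : rscal phi) : rscal phi ⊗ rscal phi := tens s 1 - tens 1 s.
have lu : linear u by move=> c x y; rewrite /u rmorphD rmorphM.
have uE (a : A) : u a = a *: u (1 : A).
  by rewrite /u -[RHS]/(phi a * phi 1) rmorph1 mulr1.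
have lv : linear v by rewrite /v; lin.
have l1 : linear (fun s : rscal phi => tens (1 : A^o) s) by exact: lin_tensr.
suff ex : exact_pair u v.
  move=> e; have /ex[a <-] : v s = 0 by rewrite /v e subrr.
  by exists a.
apply: ff_exact => // z; split; last first.
  move=> [x <-]; move: x; apply: tens_ext => [||a t].
  - by apply: lin_comp; exact: lin_tmap.
  - by move=> c x y; rewrite scaler0 addr0.
  rewrite !tmapE //; have -> : v (u a) = 0; last first.
    exact: (lin0 (@lin_tensl _ _ _ t)).
  rewrite /v uE /u rmorph1 (linZ _ _ (@lin_tensl _ _ _ _)).
  rewrite (linZ _ _ (@lin_tensr _ _ _ _)).
  exact: subrr.
pose m : (rscal phi ⊗ rscal phi) ⊗ rscal phi -> rscal phi ⊗ rscal phi :=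
  tlift (fun x c => tlift (fun a b => tens a (b * c)) x).
pose n : rscal phi ⊗ rscal phi -> A^o ⊗ rscal phi :=
  tlift (fun a b => tens 1 (a * b)).
have lm : linear m by rewrite /m; lin.
have ln : linear n.
  rewrite /n; apply: lin_tlift => [b|a] /=; last by lin.
  apply: (lin_comp l1); exact: (lin_mull (f := fun x => x)).
move=> z0; exists (n z); apply/esym/eqP; rewrite -subr_eq0; apply/eqP.
have <- : m (tmap v id z) = z - tmap u id (n z); last by rewrite z0 (lin0 lm).
move: z {z0}; apply: tens_ext => [||a b].
- by apply: (lin_comp lm); exact: lin_tmap.
- apply: lin_add; first exact: lin_id.
  by apply: lin_opp; apply: (lin_comp _ ln); exact: lin_tmap.
rewrite tmapE // /n tliftE; last first.
  split=> [y|x]; last by lin.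
  apply: (lin_comp l1); exact: (lin_mull (f := fun x => x)).
rewrite tmapE // /m tliftE; last by split=> ? /=; lin.
rewrite /v (linD _ _ (lin_tlift _ _)) /=; [|by move=> ?; lin|by move=> ?; lin].
rewrite -scaleN1r (linZ _ _ (lin_tlift _ _)) /=;
  [|by move=> ?; lin|by move=> ?; lin].
by tE; tE; rewrite mul1r scaleN1r /u rmorph1.
Qed.

End FaithfulFlatness.

Section Pushout.
Context (k : fieldType) (A S R : comAlgType k).
Context (phi : {lrmorphism A -> S}) (g : {lrmorphism A -> R}).
Hypothesis ff : faithfully_flat phi.

(** By faithful flatness R embeds in S ⊗_A R through r |-> 1 ⊗ r, so 1 ⊗ 1 = 0 would force 1 = 0 in
    R. *)
Lemma pushout_nz : tens 1 1 != 0 :> rscal phi ⊗ rscal g.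
Proof.
apply/eqP => e; have /eqP := oner_neq0 R; apply.
apply: (@ff_tens1_inj _ _ _ ff (rscal g)).
by rewrite [LHS]e (lin0 (@lin_tensr _ _ _ _)).
Qed.

(** [tens_alg] is an algebra over A; its k-structure is obtained by restriction along k -> A -> S
    ⊗_A R. *)
Definition pushout_scal : {rmorphism k -> tens_alg pushout_nz} :=
  in_alg (tens_alg pushout_nz) \o in_alg A.

Definition pushout : comAlgType k := rscal pushout_scal.

Definition push_l (s : S) : pushout := talg_inl pushout_nz s.
Definition push_r (r : R) : pushout := talg_inr pushout_nz r.

Lemma push_glue a : push_l (phi a) = push_r (g a).
Proof.
rewrite /push_l /push_r /talg_inl /talg_inr.
pose u : rscal phi := 1; pose v : rscal g := 1.
have -> : phi a = a *: u :> rscal phi by rewrite -[RHS]/(phi a * 1) mulr1.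
have -> : g a = a *: v :> rscal g by rewrite -[RHS]/(g a * 1) mulr1.
by rewrite (linZ _ _ (@lin_tensl _ _ _ _)) (linZ _ _ (@lin_tensr _ _ _ _)).
Qed.

Lemma pushout_scaleE (c : k) (x : tens_alg pushout_nz) :
  c *: (x : pushout) = (c%:A : A) *: x.
Proof. exact: (mulr_algl (c%:A : A) x). Qed.

Lemma rscal_algE (B : comAlgType k) (f : {lrmorphism A -> B}) (c : k) (x : B) :
  (c%:A : A) *: (x : rscal f) = c *: x.
Proof.
rewrite -[LHS]/(f c%:A * x); have -> : f c%:A = c%:A by exact: rmorph_alg.
by rewrite -scalerAl mul1r.
Qed.

Lemma push_l_linear : linear push_l.
Proof.
move=> c x y; rewrite /push_l pushout_scaleE.
have -> : c *: x + y = (c%:A : A) *: (x : rscal phi) + (y : rscal phi).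
  by rewrite rscal_algE.
exact: (@talg_inl_linear _ _ _ pushout_nz (c%:A : A) x y).
Qed.

Lemma push_r_linear : linear push_r.
Proof.
move=> c x y; rewrite /push_r pushout_scaleE.
have -> : c *: x + y = (c%:A : A) *: (x : rscal g) + (y : rscal g).
  by rewrite rscal_algE.
exact: (@talg_inr_linear _ _ _ pushout_nz (c%:A : A) x y).
Qed.

HB.instance Definition _ :=
  GRing.isLinear.Build k S pushout *:%R push_l push_l_linear.
HB.instance Definition _ :=
  GRing.isLinear.Build k R pushout *:%R push_r push_r_linear.
HB.instance Definition _ := GRing.isMonoidMorphism.Build S pushout push_l
  (talg_inl_monoid pushout_nz).
HB.instance Definition _ := GRing.isMonoidMorphism.Build R pushout push_r
  (talg_inr_monoid pushout_nz).

(** Because of this, identities over R may be checked in the pushout, where data defined over the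
    cover S are available too. *)
Lemma push_r_inj : injective push_r.
Proof. exact: (@ff_tens1_inj _ _ _ ff (rscal g)). Qed.

End Pushout.

(** * Tensor products over the base field *)

Section FieldTensor.
Context (k : fieldType).

(** A functional on B with value 1 at 1 contracts 1 ⊗ 1 to the unit of A. *)
Lemma field_tens_nz (A B : comAlgType k) : tens 1 1 != 0 :> A ⊗ B.
Proof.
have s0 (V : lmodType k) : subspace (fun v : V => v = 0).
  by split=> // c x y -> ->; rewrite scaler0 addr0.
have n0 (C : comAlgType k) : ~ ((1 : C) = 0) by move/eqP; rewrite oner_eq0.
have [alpha [la _ a1]] := functional_sep (s0 B) (n0 B).
apply/eqP => e; apply: (n0 A).
have := contractE (1 : A) (1 : B) la.
by rewrite a1 scale1r e (lin0 (lin_contract la)).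
Qed.

Definition ftens (A B : comAlgType k) : comAlgType k :=
  tens_alg (field_tens_nz A B).

Definition ftens_l (A B : comAlgType k) : {lrmorphism A -> ftens A B} :=
  talg_inl (field_tens_nz A B).
Definition ftens_r (A B : comAlgType k) : {lrmorphism B -> ftens A B} :=
  talg_inr (field_tens_nz A B).

Lemma ftensE (A B : comAlgType k) (a : A) (b : B) :
  ftens_l A B a * ftens_r A B b = tens a b.
Proof.
rewrite -[LHS]/(talg_mul _ _).
by rewrite [LHS](talg_mulE (field_tens_nz A B)) mulr1 mul1r.
Qed.

Definition tswap (V W : lmodType k) : V ⊗ W -> W ⊗ V :=
  tlift (fun v w => tens w v).

Lemma lin_tswap (V W : lmodType k) : linear (@tswap V W).
Proof. by rewrite /tswap; lin. Qed.

Lemma tswapE (V W : lmodType k) (v : V) (w : W) : tswap (tens v w) = tens w v.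
Proof. by rewrite /tswap; tE. Qed.

Lemma tswapK (V W : lmodType k) : cancel (@tswap V W) (@tswap W V).
Proof.
apply: tens_ext => [||v w]; last by rewrite !tswapE.
- by apply: lin_comp; exact: lin_tswap.
- exact: lin_id.
Qed.

Lemma tswap_tmap (U V W X : lmodType k) (f : U -> V) (g : W -> X) z :
  linear f -> linear g -> tswap (tmap f g z) = tmap g f (tswap z).
Proof.
move=> lf lg; move: z; apply: tens_ext => [||u w].
- by apply: lin_comp; [exact: lin_tswap|exact: lin_tmap].
- by apply: lin_comp; [exact: lin_tmap|exact: lin_tswap].
- by rewrite tmapE // !tswapE tmapE.
Qed.

Lemma tmap_comp (U V W X Y Z : lmodType k) (f : U -> V) (f' : V -> W)
    (g : X -> Y) (g' : Y -> Z) z :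
  linear f -> linear f' -> linear g -> linear g' ->
  tmap f' g' (tmap f g z) = tmap (fun x => f' (f x)) (fun x => g' (g x)) z.
Proof.
move=> lf lf' lg lg'; move: z; apply: tens_ext => [||u w].
- by apply: lin_comp; exact: lin_tmap.
- by apply: lin_tmap; exact: lin_comp.
- by rewrite !tmapE //; exact: lin_comp.
Qed.

Lemma tmap_compl (U V W X : lmodType k) (f : U -> V) (f' : V -> W) (z : U ⊗ X) :
  linear f -> linear f' ->
  tmap f' id (tmap f id z) = tmap (fun x => f' (f x)) id z.
Proof. by move=> lf lf'; rewrite tmap_comp. Qed.

Lemma tmap_exchange (U V X Y : lmodType k) (f : U -> V) (g : X -> Y) z :
  linear f -> linear g -> tmap id g (tmap f id z) = tmap f id (tmap id g z).
Proof. by move=> lf lg; rewrite !tmap_comp. Qed.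

Lemma tmap_id (U V : lmodType k) (z : U ⊗ V) : tmap id id z = z.
Proof.
move: z; apply: tens_ext => [||u w]; last by rewrite tmapE.
- exact: lin_tmap.
- exact: lin_id.
Qed.

Lemma eq_tmap (U V W X : lmodType k) (f f' : U -> V) (g g' : W -> X) z :
  f =1 f' -> g =1 g' -> tmap f g z = tmap f' g' z.
Proof. by move=> ef eg; apply: eq_tlift => u w; rewrite ef eg. Qed.

Lemma tmap_inj_r (V X Y : lmodType k) (g : X -> Y) : linear g -> injective g ->
  injective (tmap id g : V ⊗ X -> V ⊗ Y).
Proof.
move=> lg ig x y e; apply: (can_inj (@tswapK _ _)).
by apply: (tmap_inj lg ig); rewrite -!tswap_tmap // e.
Qed.

(** A tensor lies in V ⊗ phi(A) once all its contractions by functionals on V lie in phi(A).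
    Contraction commutes with both maps to the pushout, so [ff_descent] applies to each contraction.
    The swap is there because [tens_sub_contract] deals with subspaces of the left factor. *)
Lemma tens_descent (A S : comAlgType k) (phi : {lrmorphism A -> S})
    (ff : faithfully_flat phi) (V : lmodType k) (w : V ⊗ S) :
  tmap id (push_l phi ff) w = tmap id (push_r phi ff) w ->
  exists v : V ⊗ A, tmap id phi v = w.
Proof.
move=> e; have lphi : linear phi by exact: linearP.
pose W s := exists a, phi a = s.
have sW : subspace W.
  split=> [|c _ _ [a <-] [b <-]]; first by exists 0; rewrite linear0.
  by exists (c *: a + b); rewrite linearP.
have [beta lb|t [tW wE]] := @tens_sub_contract k S V W (tswap w) sW.
  have lC (X : lmodType k) := @lin_contract k X V beta lb.
  have cb (h : S -> pushout phi ff) : linear h ->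
      h (contract beta (tswap w)) = contract beta (tswap (tmap id h w)).
    by move=> lh; rewrite tswap_tmap // -tmap_contract.
  have [a aE] : exists a, phi a = contract beta (tswap w) :> S.
    apply: (ff_descent ff).
    by rewrite -[LHS]/(push_l phi ff _) -[RHS]/(push_r phi ff _) !cb ?e //;
      exact: linearP.
  by exists a.
rewrite -[w]tswapK {e}wE; elim: t tW => [|p t IH] tW.
  by exists 0; rewrite big_nil (lin0 (@lin_tswap _ _)) (lin0 (lin_tmap _ _)).
have [|v vE] := IH; first by move=> q qt; apply: tW; rewrite in_cons qt orbT.
have [a aE] : W p.1 by apply: tW; rewrite mem_head.
exists (tens p.2 a + v); rewrite (linD _ _ (lin_tmap _ _)) // vE tmapE // aE.
by rewrite big_cons (linD _ _ (@lin_tswap _ _)) tswapE.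
Qed.

End FieldTensor.

Section PointCalculus.
Context (k : fieldType) (G : algGroup k).

(** Proof irrelevance turns pointwise equality into equality, so that the group laws on points
    become rewriting rules, also under [act]. *)
Lemma lrmorphism_eq (A B : comAlgType k) (g h : {lrmorphism A -> B}) :
  g =1 h -> g = h.
Proof.
case: g => [g [[ga] [gb] [gc]]]; case: h => [h [[ha] [hb] [hc]]] /= e.
have {}e : g = h by apply/funext.
subst h.
by rewrite (Prop_irrelevance ga ha) (Prop_irrelevance gb hb)
  (Prop_irrelevance gc hc).
Qed.

End PointCalculus.

(** * Points and functions on G *)

Section PointGroup.
Context (k : fieldType) (G : algGroup k).

Definition gcomp (R S : comAlgType k) (phi : {lrmorphism R -> S})
  (g : gpoint G R) : gpoint G S := (phi \o g : {lrmorphism _ -> _}).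

Section Laws.
Context (R : comAlgType k).
Implicit Types g h u : gpoint G R.

Lemma gpmulA g h u : gmul g (gmul h u) = gmul (gmul g h) u.
Proof. exact/lrmorphism_eq/gmulA. Qed.
Lemma gpmul1 g : gmul g (gone G R) = g.
Proof. exact/lrmorphism_eq/gmul1. Qed.
Lemma gp1mul g : gmul (gone G R) g = g.
Proof. exact/lrmorphism_eq/g1mul. Qed.
Lemma gpmulV g : gmul g (ginv g) = gone G R.
Proof. exact/lrmorphism_eq/gmulV. Qed.
Lemma gpmulVl g : gmul (ginv g) g = gone G R.
Proof. exact/lrmorphism_eq/gmulVl. Qed.
Lemma gpinvM g h : ginv (gmul g h) = gmul (ginv h) (ginv g).
Proof. exact/lrmorphism_eq/ginvM. Qed.
Lemma gpKmul g h : gmul (ginv g) (gmul g h) = h.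
Proof. by rewrite gpmulA gpmulVl gp1mul. Qed.
Lemma gpVKmul g h : gmul g (gmul (ginv g) h) = h.
Proof. by rewrite gpmulA gpmulV gp1mul. Qed.
Lemma gpinvK g : ginv (ginv g) = g.
Proof. by rewrite -[LHS](gpmul1) -(gpmulVl g) gpKmul. Qed.
Lemma gpinv1 : ginv (gone G R) = gone G R.
Proof. exact/lrmorphism_eq/ginv1. Qed.

End Laws.

Lemma gcompM (R S : comAlgType k) (phi : {lrmorphism R -> S})
    (g h : gpoint G R) :
  gcomp phi (gmul g h) = gmul (gcomp phi g) (gcomp phi h).
Proof.
apply: lrmorphism_eq => a; rewrite /= /gmul_fun; move: (comul G a).
apply: tens_ext => [||b c]; [by lin|by lin|].
by tE; tE; rewrite /= rmorphM.
Qed.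

Lemma gcompV (R S : comAlgType k) (phi : {lrmorphism R -> S}) (g : gpoint G R) :
  gcomp phi (ginv g) = ginv (gcomp phi g).
Proof. exact: lrmorphism_eq. Qed.

Lemma gcomp_mem (H : closedSubgroup G) (R S : comAlgType k)
    (phi : {lrmorphism R -> S}) (g : gpoint G R) :
  mem_point H g -> mem_point H (gcomp phi g).
Proof. by move=> Hg a Ha; rewrite /= Hg // raddf0. Qed.

Lemma full_mem (R : comAlgType k) (g : gpoint G R) : mem_point (fullG G) g.
Proof. exact: vanishes0. Qed.

Lemma capG_mem (H K : closedSubgroup G) (R : comAlgType k) (g : gpoint G R) :
  mem_point (capG H K) g <-> mem_point H g /\ mem_point K g.
Proof. exact: vanishes_cap. Qed.

End PointGroup.

Section SemilinearExtension.
Context (k : fieldType).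

Lemma tens_tscale (V : lmodType k) (R : comAlgType k) (v : V) (r : R) :
  tens v r = tscale r (tens v 1).
Proof. by rewrite tscaleE mulr1. Qed.

(* V ⊗ R is generated over R by the elements v ⊗ 1. *)
Lemma tens1_ext (U V : lmodType k) (R S : comAlgType k) (c : R -> S)
    (f g : U ⊗ R -> V ⊗ S) :
  linear f -> linear g ->
  (forall r x, f (tscale r x) = tscale (c r) (f x)) ->
  (forall r x, g (tscale r x) = tscale (c r) (g x)) ->
  (forall u, f (tens u 1) = g (tens u 1)) -> f =1 g.
Proof.
move=> lf lg sf sg e; apply: tens_ext => // u r.
by rewrite tens_tscale sf sg e.
Qed.

Lemma tmap_tscale_r (V : lmodType k) (R S : comAlgType k)
    (phi : {lrmorphism R -> S}) r (x : V ⊗ R) :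
  tmap id phi (tscale r x) = tscale (phi r) (tmap id phi x).
Proof.
have lp : linear phi by exact: linearP.
move: x; apply: tens_ext => [||v s].
- by apply: lin_comp; [exact: lin_tmap|exact: lin_tscale].
- by apply: lin_comp; [exact: lin_tscale|exact: lin_tmap].
- by rewrite tscaleE !tmapE // tscaleE rmorphM.
Qed.

End SemilinearExtension.

Lemma tmap_gcomp (k : fieldType) (G : algGroup k) (V : lmodType k)
    (R S : comAlgType k) (phi : {lrmorphism R -> S}) (g : gpoint G R)
    (f : V ⊗ G) :
  tmap id phi (tmap id g f) = tmap id (gcomp phi g) f.
Proof. by rewrite tmap_comp //; exact: linearP. Qed.

Section ActionCalculus.
Context (k : fieldType) (G : algGroup k) (H : closedSubgroup G) (M : gmodule H).

Lemma act_tscale (R : comAlgType k) (g : gpoint G R) r (x : M ⊗ R) :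
  mem_point H g -> act g (tscale r x) = tscale r (act g x).
Proof.
move=> Hg; have := act_lin Hg r x 0.
by rewrite (lin0 (act_lin_k Hg)) !addr0.
Qed.

Lemma actVK (R : comAlgType k) (g : gpoint G R) (x : M ⊗ R) :
  mem_point H g -> act (ginv g) (act g x) = x.
Proof.
by move=> Hg; rewrite -act_mul ?gpmulVl ?act_one //; exact: idl_inv.
Qed.

Lemma actKV (R : comAlgType k) (g : gpoint G R) (x : M ⊗ R) :
  mem_point H g -> act g (act (ginv g) x) = x.
Proof.
by move=> Hg; rewrite -act_mul ?gpmulV ?act_one //; exact: idl_inv.
Qed.

Lemma act_gcomp (R S : comAlgType k) (phi : {lrmorphism R -> S})
    (g : gpoint G R) (x : M ⊗ R) : mem_point H g ->
  tmap id phi (act g x) = act (gcomp phi g) (tmap id phi x).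
Proof. by move=> Hg; apply: act_nat. Qed.

End ActionCalculus.

Section PointEvaluation.
Context (k : fieldType) (G : algGroup k).

(* Elements of V ⊗ k[G] are viewed as V-valued functions on G: the value of f
   at g in G(R) is [tmap id g f]. [peval iota g] is the same for R-families of
   such functions, at points over an R-algebra. *)
Definition peval (V : lmodType k) (R S : comAlgType k)
    (iota : {lrmorphism R -> S}) (g : gpoint G S) : (V ⊗ G) ⊗ R -> V ⊗ S :=
  tlift (fun f r => tscale (iota r) (tmap id g f)).

Section Basics.
Context (V : lmodType k) (R S : comAlgType k) (iota : {lrmorphism R -> S}).
Implicit Types (g : gpoint G S) (z : (V ⊗ G) ⊗ R).

Lemma bilin_peval g :
  bilin (fun (f : V ⊗ G) (r : R) => tscale (iota r) (tmap id g f)).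
Proof.
have lg : linear g by exact: linearP.
split=> [r|f].
  apply: (lin_comp (g := tscale (iota r))); first exact: lin_tscale.
  exact: lin_tmap.
apply: (lin_comp (g := fun s : S => tscale s _)); first exact: lin_tscalel.
exact: linearP.
Qed.

Lemma lin_peval g : linear (@peval V R S iota g).
Proof. exact/linear_tlift/bilin_peval. Qed.

Lemma pevalE g (f : V ⊗ G) (r : R) :
  peval iota g (tens f r) = tscale (iota r) (tmap id g f).
Proof. by rewrite /peval tliftE //; exact: bilin_peval. Qed.

Lemma peval3E g (v : V) a (r : R) :
  peval iota g (tens (tens v a) r) = tens v (iota r * g a).
Proof. by rewrite pevalE tmapE ?tscaleE //; exact: linearP. Qed.

Lemma peval1 g (f : V ⊗ G) : peval iota g (tens f 1) = tmap id g f.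
Proof.
rewrite pevalE rmorph1; move: (tmap _ _ _).
by apply: tens_ext => [||v s]; [exact: lin_tscale|lin|rewrite tscaleE mul1r].
Qed.

Lemma peval_tscale g r z :
  peval iota g (tscale r z) = tscale (iota r) (peval iota g z).
Proof.
move: z; apply: tens3_ext => [||v a s].
- by apply: lin_comp; [exact: lin_peval|exact: lin_tscale].
- by apply: lin_comp; [exact: lin_tscale|exact: lin_peval].
- by rewrite tscaleE !peval3E tscaleE rmorphM mulrA.
Qed.

End Basics.

Lemma peval_nat (V : lmodType k) (R S S' : comAlgType k)
    (iota : {lrmorphism R -> S}) (phi : {lrmorphism S -> S'}) (g : gpoint G S)
    (z : (V ⊗ G) ⊗ R) :
  tmap id phi (peval iota g z) =
  peval ((phi \o iota : {lrmorphism _ -> _})) (gcomp phi g) z.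
Proof.
have lp : linear phi by exact: linearP.
move: z; apply: tens3_ext => [||v a s].
- by apply: lin_comp; [exact: lin_tmap|exact: lin_peval].
- exact: lin_peval.
- by rewrite !peval3E tmapE //= rmorphM.
Qed.

(** The universal case suffices: over S = k[G] ⊗ R, evaluation at the point a |-> a ⊗ 1 merely
    reorders the factors, and [back] undoes it. *)
Lemma peval_inj (V : lmodType k) (R : comAlgType k) (z z' : (V ⊗ G) ⊗ R) :
  (forall (S : comAlgType k) (iota : {lrmorphism R -> S}) (g : gpoint G S),
     peval iota g z = peval iota g z') -> z = z'.
Proof.
move=> e; pose back : V ⊗ ftens G R -> (V ⊗ G) ⊗ R :=
  tlift (fun v x => tlift (fun a r => tens (tens v a) r) (x : G ⊗ R)).
have lb : linear back by rewrite /back; lin.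
have backK x : back (peval (ftens_r G R) (ftens_l G R) x) = x.
  move: x; apply: tens3_ext => [||v a r].
  - by apply: (lin_comp lb); exact: lin_peval.
  - exact: lin_id.
  rewrite peval3E mulrC ftensE /back tliftE; last by split=> ? /=; lin.
  by tE.
by rewrite -(backK z) e backK.
Qed.

Lemma peval_ltrans (H : closedSubgroup G) (N : gmodule H) (R S : comAlgType k)
    (iota : {lrmorphism R -> S}) (u : gpoint G R) (g : gpoint G S) z :
  peval iota g (@ind_ltrans k G H N R u z) =
  peval iota (gmul (gcomp iota u) g) z.
Proof.
move: z; apply: tens3_ext => [||v a r].
- by apply: lin_comp; [exact: lin_peval|exact: lin_ind_ltrans].
- exact: lin_peval.
rewrite ind_ltransE peval3E /= /gmul_fun; move: (comul G a).
apply: tens_ext => [||b c].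
- by apply: (lin_comp (lin_peval iota g)); lin.
- by lin.
by tE; tE; rewrite peval3E rmorphM mulrA.
Qed.

Lemma peval_hact (H : closedSubgroup G) (N : gmodule H) (R S : comAlgType k)
    (iota : {lrmorphism R -> S}) (h : gpoint G R) (g : gpoint G S) (f : N ⊗ G) :
  mem_point H h ->
  peval iota g (ind_hact h f) =
  act (gcomp iota h) (tmap id (gmul g (gcomp iota h)) f).
Proof.
move=> Hh; have Hh' : mem_point H (gcomp iota h) by exact: gcomp_mem.
have lm : linear (gmul g (gcomp iota h)) by exact: linearP.
have li : linear iota by exact: linearP.
have lp := lin_peval (V := N) iota g.
move: f; apply: tens_ext => [||n a].
- by apply: (lin_comp lp); exact: lin_ind_hact.
- by apply: lin_comp; [exact: act_lin_k|exact: lin_tmap].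
rewrite /ind_hact tliftE; last exact: bilin_ind_hact.
rewrite tmapE // tens_tscale act_tscale //.
(* The element n ⊗ 1 comes from R, so the action of [gcomp iota h] on it comes from that of h by
   naturality. *)
have -> : tens n 1 = tmap id iota (tens n 1) by rewrite tmapE // rmorph1.
rewrite -act_gcomp //; move: (act h _) => x.
rewrite /rtrans /= /gmul_fun; move: (comul G a) => y.
move: x; apply: tens_ext => [||m r].
- by apply: (lin_comp lp); exact: lin_tcombl.
- by apply: lin_comp; [exact: lin_tscale|exact: lin_tmap].
rewrite tmapE // tscaleE; move: y; apply: tens_ext => [||b c].
- apply: (lin_comp lp); apply: (lin_comp (g := tcomb _)).
    exact: lin_tcombr.
  by lin.
- by lin.
tE; tE; rewrite /tcomb; tE; tE; rewrite peval3E rmorphM /=.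
by rewrite mulrC [iota r * _]mulrC mulrA.
Qed.

(** In terms of values, [ind_hact] is (h f)(g) = h f(g h). Invariance thus becomes the classical
    condition f(g h) = h^-1 f(g), the form used from here on. *)
Lemma ind_invP (H : closedSubgroup G) (N : gmodule H) (f : N ⊗ G) :
  ind_inv f <-> forall (R : comAlgType k) (g h : gpoint G R), mem_point H h ->
    tmap id (gmul g h) f = act (ginv h) (tmap id g f).
Proof.
split=> [If R g h Hh|If R h Hh].
  have := congr1 (peval idfun g) (If R h Hh).
  rewrite peval1 peval_hact // => <-.
  by rewrite (_ : gcomp _ h = h) ?actVK //; exact: lrmorphism_eq.
apply: peval_inj => S iota g; rewrite peval1 peval_hact // If ?actKV //;
  exact: gcomp_mem.
Qed.

End PointEvaluation.

(** * Frobenius reciprocity *)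

Section Homomorphisms.
Context (k : fieldType) (G : algGroup k).
Implicit Types H L : closedSubgroup G.

Lemma ghom_tens1 H (M N : gmodule H) (f : M -> N) : linear f ->
  (forall (R : comAlgType k) (g : gpoint G R), mem_point H g ->
     forall m, tmap f id (act g (tens m 1)) = act g (tens (f m) 1)) ->
  ghom f.
Proof.
move=> lf e; split=> // R g Hg; apply: (tens1_ext (c := id)).
- by apply: lin_comp; [exact: lin_tmap|exact: act_lin_k].
- by apply: lin_comp; [exact: act_lin_k|exact: lin_tmap].
- by move=> r x; rewrite act_tscale // tmap_tscale.
- by move=> r x; rewrite tmap_tscale // act_tscale.
- by move=> m; rewrite e // tmapE.
Qed.

Lemma ghom_id H (M : gmodule H) : ghom (fun x : M => x).
Proof. by split=> // R g Hg x; rewrite !tmap_id. Qed.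

Lemma ghom_comp H (M N P : gmodule H) (f : M -> N) (g : N -> P) :
  ghom f -> ghom g -> ghom (fun x => g (f x)).
Proof.
move=> [lf hf] [lg hg]; split=> [|R u Hu x]; first exact: lin_comp.
by rewrite -!(tmap_compl (f := f)) // hf // hg.
Qed.

Lemma ghom_sub H (M N : gmodule H) (f g : M -> N) :
  ghom f -> ghom g -> ghom (fun x => f x - g x).
Proof.
move=> hf hg; have := (ghom_subspace M N).2 (-1) g f hg hf.
congr (ghom _); apply/funext => x.
by rewrite -[LHS]/(_ *: _ + _) scaleN1r addrC.
Qed.

Lemma ghom_res L H (LH : subgroup_le L H) (M N : gmodule H) (f : M -> N) :
  ghom f -> ghom (f : res LH M -> res LH N).
Proof. by move=> [lf hf]; split=> // R g Lg x; apply: hf; exact: mem_le Lg. Qed.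

End Homomorphisms.

Section InducedModule.
Context (k : fieldType) (G : algGroup k) (H : closedSubgroup G).
Section Coordinates.
Context (N : gmodule H).

Definition ival (f : ind N) : N ⊗ G := val (f : ind_car N).

Lemma lin_ival : linear ival. Proof. exact: lin_val. Qed.

Lemma ival_inj : injective ival. Proof. exact: val_inj. Qed.

Lemma ivalP (f : ind N) : ind_inv (ival f).
Proof. by case: f => f If; apply/(subsp_predP (ind_inv_subspace N)). Qed.

Lemma ival_ex (f : N ⊗ G) : ind_inv f -> exists f' : ind N, ival f' = f.
Proof. by move/(subsp_predP (ind_inv_subspace N)) => If; exists (Subsp If). Qed.

Definition ieval (R S : comAlgType k) (iota : {lrmorphism R -> S})
    (g : gpoint G S) (x : ind N ⊗ R) : N ⊗ S := peval iota g (tmap ival id x).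

Lemma lin_ieval (R S : comAlgType k) (iota : {lrmorphism R -> S})
  (g : gpoint G S) : linear (ieval iota g).
Proof.
apply: lin_comp; first exact: lin_peval.
exact: lin_tmap lin_ival (@lin_id _ _).
Qed.

Lemma ieval_tscale (R S : comAlgType k) (iota : {lrmorphism R -> S})
    (g : gpoint G S) r x :
  ieval iota g (tscale r x) = tscale (iota r) (ieval iota g x).
Proof. by rewrite /ieval tmap_tscale ?peval_tscale //; exact: lin_ival. Qed.

Lemma ieval1 (R S : comAlgType k) (iota : {lrmorphism R -> S})
    (g : gpoint G S) (f : ind N) :
  ieval iota g (tens f 1) = tmap id g (ival f).
Proof. by rewrite /ieval tmapE ?peval1 //; exact: lin_ival. Qed.

Lemma ieval_act (R S : comAlgType k) (iota : {lrmorphism R -> S})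
    (u : gpoint G R) (g : gpoint G S) x :
  ieval iota g (act u x) = ieval iota (gmul (gcomp iota (ginv u)) g) x.
Proof.
rewrite /ieval -[tmap ival id (act u x)]/(ind_incl (ind_act u x)) ind_actP.
by rewrite peval_ltrans.
Qed.

Lemma ieval_nat (R S S' : comAlgType k) (iota : {lrmorphism R -> S})
    (phi : {lrmorphism S -> S'}) (g : gpoint G S) x :
  tmap id phi (ieval iota g x) =
  ieval ((phi \o iota : {lrmorphism _ -> _})) (gcomp phi g) x.
Proof. exact: peval_nat. Qed.

Lemma ieval_inj (R : comAlgType k) (x y : ind N ⊗ R) :
  (forall (S : comAlgType k) (iota : {lrmorphism R -> S}) (g : gpoint G S),
     ieval iota g x = ieval iota g y) -> x = y.
Proof.
by move=> e; apply: (tmap_inj lin_ival ival_inj); exact: peval_inj.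
Qed.

(** Evaluation at the identity, f |-> f(1): the counit of Frobenius reciprocity. *)
Definition ind_counit (f : ind N) : N := contract (counit G) (ival f).

Lemma lin_ind_counit : linear ind_counit.
Proof.
apply: (lin_comp (f := ival)); last exact: lin_ival.
by apply: lin_contract; exact: linearP.
Qed.

Lemma ind_counitE (R : comAlgType k) (f : ind N) :
  tens (ind_counit f) (1 : R) = tmap id (gone G R) (ival f).
Proof.
have l1 : linear (gone G R) by exact: linearP.
have lc : linear (counit G) by exact: linearP.
rewrite /ind_counit; move: (ival f); apply: tens_ext => [||n a].
- apply: (lin_comp (g := fun n => tens n 1)); first exact: lin_tensl.
  exact: lin_contract.
- exact: lin_tmap.
rewrite contractE // tmapE //= /gone_fun (linZ _ _ (@lin_tensl _ _ _ _)).
by rewrite (linZ _ _ (@lin_tensr _ _ _ _)).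
Qed.

Lemma tmap_ind_counit (R : comAlgType k) (x : ind N ⊗ R) :
  tmap ind_counit id x = ieval idfun (gone G R) x.
Proof.
move: x; apply: (tens1_ext (c := id)).
- by apply: lin_tmap; first exact: lin_ind_counit.
- exact: lin_ieval.
- by move=> r x; apply: tmap_tscale; exact: lin_ind_counit.
- by move=> r x; rewrite ieval_tscale.
- by move=> f; rewrite tmapE ?ieval1 ?ind_counitE //; exact: lin_ind_counit.
Qed.

(** For h in H, (h f)(1) = f(h^-1) = h f(1). *)
Lemma ind_counit_hom : ghom (ind_counit : res (le_full H) (ind N) -> N).
Proof.
apply: ghom_tens1 => [|R h Hh f]; first exact: lin_ind_counit.
have Hh' : mem_point H (ginv h) by exact: idl_inv.
rewrite tmap_ind_counit [LHS]ieval_act ieval1 gpmul1 ind_counitE.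
rewrite (_ : gcomp _ _ = gmul (gone G R) (ginv h)).
  by have /ind_invP -> := ivalP f; rewrite ?gpinvK.
by rewrite gp1mul; exact: lrmorphism_eq.
Qed.

(* The value at g is computed by moving g to the argument. *)
Lemma ind_hom_counit (M : gmodule (fullG G)) (f : M -> ind N) m : ghom f ->
  forall (R : comAlgType k) (g : gpoint G R),
  tmap id g (ival (f m)) =
  tmap (fun x => ind_counit (f x)) id (act (ginv g) (tens m 1)).
Proof.
move=> [lf hf] R g.
rewrite -(tmap_compl (f := f)) //; last exact: lin_ind_counit.
rewrite hf; last exact: full_mem.
rewrite tmapE // tmap_ind_counit ieval_act ieval1 gpmul1 gpinvK.
by rewrite (_ : gcomp _ _ = g) //; exact: lrmorphism_eq.
Qed.

(** Uniqueness in Frobenius reciprocity: [ind_hom_counit] recovers all values from the counit, and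
    the value at the generic point is the function itself. *)
Lemma ind_hom_eq (M : gmodule (fullG G)) (f f' : M -> ind N) :
  ghom f -> ghom f' ->
  (forall m, ind_counit (f m) = ind_counit (f' m)) -> f =1 f'.
Proof.
move=> hf hf' e m; apply: ival_inj; pose g : gpoint G G := idfun.
have gE x : tmap id g x = x :> N ⊗ G by exact: tmap_id.
rewrite -[LHS]gE -[RHS]gE !(ind_hom_counit (M := M)) //.
exact: eq_tmap.
Qed.

Section Transpose.
Context (M : gmodule (fullG G)) (phi : M -> N)
  (hphi : ghom (phi : res (le_full H) M -> N)).
Let generic : gpoint G G := idfun.

(** The function g |-> phi(g^-1 m), obtained by evaluating this formula at the generic point. *)
Definition transpose_val (m : M) : N ⊗ G :=
  tmap phi id (act (ginv generic) (tens m 1)).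

Lemma transpose_valE (R : comAlgType k) (g : gpoint G R) (m : M) :
  tmap id g (transpose_val m) = tmap phi id (act (ginv g) (tens m 1)).
Proof.
have lg : linear g by exact: linearP.
have lphi : linear phi := hphi.1.
have Gg : mem_point (fullG G) (ginv generic) by exact: full_mem.
rewrite /transpose_val tmap_exchange // act_gcomp // tmapE // rmorph1.
by congr (tmap _ _ (act _ _)); exact: lrmorphism_eq.
Qed.

Lemma transpose_inv (m : M) : ind_inv (transpose_val m).
Proof.
apply/ind_invP => R g h Hh; have Hh' := idl_inv Hh.
rewrite !transpose_valE gpinvM act_mul; try exact: full_mem.
by rewrite -[RHS](hphi.2).
Qed.

Definition transpose (m : M) : ind N := sval (cid (ival_ex (transpose_inv m))).

Lemma ival_transpose m : ival (transpose m) = transpose_val m.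
Proof. by rewrite /transpose; case: cid. Qed.

Lemma lin_transpose : linear transpose.
Proof.
have lphi : linear phi := hphi.1.
move=> c x y; apply: ival_inj; rewrite lin_ival !ival_transpose /transpose_val.
rewrite (lin_tensl 1 c x y) (act_lin_k (full_mem _)).
by rewrite (lin_tmap lphi (@lin_id _ _)).
Qed.

Lemma ieval_transpose (R S : comAlgType k) (iota : {lrmorphism R -> S})
    (g : gpoint G S) (x : M ⊗ R) :
  ieval iota g (tmap transpose id x) =
  tmap phi id (act (ginv g) (tmap id iota x)).
Proof.
have lphi : linear phi := hphi.1; have li : linear iota by exact: linearP.
have Gg : mem_point (fullG G) (ginv g) by exact: full_mem.
have lt := lin_transpose.
move: x; apply: (tens1_ext (c := iota)).
- by apply: lin_comp; [exact: lin_ieval|exact: lin_tmap].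
- apply: (lin_comp (g := tmap phi id)); first exact: lin_tmap.
  by apply: lin_comp; [exact: act_lin_k|exact: lin_tmap].
- by move=> r x; rewrite tmap_tscale // ieval_tscale.
- by move=> r x; rewrite tmap_tscale_r act_tscale // tmap_tscale.
- move=> m; rewrite tmapE // ieval1 ival_transpose transpose_valE tmapE //.
  by rewrite rmorph1.
Qed.

Lemma transpose_hom : ghom transpose.
Proof.
apply: ghom_tens1 => [|R u _ m]; first exact: lin_transpose.
have Gg (S : comAlgType k) (g : gpoint G S) := full_mem g.
apply: ieval_inj => S iota g; rewrite ieval_act ieval1 ival_transpose.
rewrite ieval_transpose act_gcomp // -act_mul // transpose_valE gpinvM gcompV.
by rewrite gpinvK tmapE ?rmorph1 //; exact: linearP.
Qed.

Lemma transposeK m : ind_counit (transpose m) = phi m.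
Proof.
have lc : linear (counit G) by exact: linearP.
have e : tens (ind_counit (transpose m)) 1 = tens (phi m) 1 :> N ⊗ G.
  rewrite ind_counitE ival_transpose transpose_valE gpinv1 act_one tmapE //.
  exact: hphi.1.
(* The counit sends 1 to 1, so contracting with it cancels [tens _ 1]. *)
have := congr1 (contract (counit G)) e.
by rewrite !contractE // rmorph1 !scale1r.
Qed.

End Transpose.
End Coordinates.

Section Functoriality.
Context (N N' : gmodule H) (d : N -> N') (hd : ghom d).

Lemma counit_comp_hom :
  ghom ((fun f => d (ind_counit f)) : res (le_full H) (ind N) -> N').
Proof. exact: ghom_comp (ind_counit_hom N) hd. Qed.

(** Defined through the adjunction, which makes it a G-homomorphism at once; [ind_map_val] shows
    that it is composition with d on values. *)
Definition ind_map : ind N -> ind N' := transpose counit_comp_hom.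

Lemma ind_map_hom : ghom ind_map.
Proof. exact: transpose_hom. Qed.

Lemma ind_counit_map f : ind_counit (ind_map f) = d (ind_counit f).
Proof. exact: (transposeK counit_comp_hom). Qed.

Lemma ind_map_val (R : comAlgType k) (g : gpoint G R) (f : ind N) :
  tmap id g (ival (ind_map f)) = tmap d id (tmap id g (ival f)).
Proof.
have [ld _] := hd; rewrite (ind_hom_counit _ ind_map_hom).
rewrite (ind_hom_counit _ (ghom_id (ind N))).
rewrite tmap_compl //; last exact: lin_ind_counit.
by apply: eq_tmap => // x; rewrite ind_counit_map.
Qed.

End Functoriality.
End InducedModule.

(** * Induction of (H ∩ K)-equivariant maps *)

(* G = K H flat-locally. The factors are exchanged with respect to
   [product_is_full H K] because elements of ind N are determined along
   the cosets y H by f (y l) = l^-1 (f y). *)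
Definition ff_product (k : fieldType) (G : algGroup k)
    (H K : closedSubgroup G) : Prop :=
  forall (R : comAlgType k) (g : gpoint G R),
    exists (S : comAlgType k) (phi : {lrmorphism R -> S}),
      faithfully_flat phi /\ exists y l : gpoint G S,
      [/\ mem_point K y, mem_point H l & gcomp phi g = gmul y l].

Section LocalProducts.
Context (k : fieldType) (G : algGroup k).
Implicit Types H K : closedSubgroup G.

(** Factor g^-1 = h x and invert: g = x^-1 h^-1. *)
Lemma product_is_full_ff H K : product_is_full H K -> ff_product H K.
Proof.
move=> HK R g; have [S [phi [[ff _] [h [x [Hh Kx e]]]]]] := HK R (ginv g).
exists S, phi; split=> //; exists (ginv x), (ginv h).
split; [exact: idl_inv|exact: idl_inv|].
rewrite -gpinvM -[g in LHS]gpinvK gcompV; congr ginv.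
exact: lrmorphism_eq.
Qed.

(** The natural isomorphism X ⊗_A A = X, given by [c] and [d], transports exactness in both
    directions. *)
Lemma idfun_faithfully_flat (A : comNzRingType) :
  faithfully_flat (idfun : {rmorphism A -> A}).
Proof.
move=> U V W u v; pose phi : {rmorphism A -> A} := idfun.
pose one : rscal phi := 1.
pose c (X : lmodType A) (x : X) : X ⊗ rscal phi := tens x one.
pose d (X : lmodType A) : X ⊗ rscal phi -> X :=
  tlift (fun x (a : rscal phi) => (a : A) *: x).
have bd (X : lmodType A) : bilin (fun (x : X) (a : rscal phi) => (a : A) *: x).
  by split=> [a|x] b y z; rewrite ?scalerDr ?scalerDl !scalerA // mulrC.
have ld (X : lmodType A) : linear (@d X) by exact/linear_tlift/bd.
have lc (X : lmodType A) : linear (@c X) by exact: lin_tensl.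
have cK (X : lmodType A) : cancel (@c X) (@d X).
  by move=> x; rewrite /d /c tliftE ?scale1r //; exact: bd.
have dK (X : lmodType A) : cancel (@d X) (@c X).
  apply: tens_ext => [||x a].
  - by apply: lin_comp; [exact: lc|exact: ld].
  - exact: lin_id.
  rewrite /d tliftE; last exact: bd.
  rewrite /c (linZ _ _ (@lin_tensl _ _ _ _)) -(linZ _ _ (@lin_tensr _ _ _ _)).
  by congr tens; rewrite -[LHS]/((a : A) * 1) mulr1.
have cn (X Y : lmodType A) (f : {linear X -> Y}) x :
    tmap f id (c X x) = c Y (f x).
  by rewrite tmapE //; exact: linearP.
have c0 (X : lmodType A) (x : X) : c X x = 0 <-> x = 0.
  split=> [e|->]; last exact: lin0 (lc X).
  by rewrite -[x]cK e (lin0 (ld X)).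
split=> ex y.
  rewrite -[y]dK; set y0 := d V y; rewrite cn c0 ex; split=> -[x xE].
    by exists (c U x); rewrite cn xE.
  by exists (d U x); apply: (can_inj (@cK V)); rewrite -cn dK.
rewrite -[v y = 0]/(v y = 0) -(c0 W) -cn ex; split=> -[x xE].
  by exists (d U x); apply: (can_inj (@cK V)); rewrite -cn dK.
by exists (c U x); rewrite cn xE.
Qed.

(** The factorization g = g 1 over the trivial cover; it allows G to replace K in the semisimple
    case. *)
Lemma ff_product_fullG H : ff_product H (fullG G).
Proof.
move=> R g; exists R, idfun; split; first exact: idfun_faithfully_flat.
exists g, (gone G R); split; [exact: full_mem|exact: idl_one|].
by rewrite gpmul1; exact: lrmorphism_eq.
Qed.

End LocalProducts.

Section EquivariantFunctoriality.
Context (k : fieldType) (G : algGroup k) (H K : closedSubgroup G).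
Hypothesis KH : ff_product H K.

(** A cover phi over which the generic point factors is itself a point y l. Evaluation there is
    [tmap id phi], which is injective because phi is. *)
Lemma ind_val_ext (V : lmodType k) (f f' : V ⊗ G) :
  (forall (R : comAlgType k) (y l : gpoint G R), mem_point K y ->
     mem_point H l -> tmap id (gmul y l) f = tmap id (gmul y l) f') -> f = f'.
Proof.
move=> e; have [S [phi [ff [y [l [Ky Hl E]]]]]] := KH (idfun : gpoint G G).
apply: (@tmap_inj_r _ _ _ _ phi); [exact: linearP|exact: ff_inj|].
have {}E : phi = gmul y l by rewrite -E; exact: lrmorphism_eq.
by rewrite E; exact: e.
Qed.

Lemma ieval_ext (N : gmodule H) (R : comAlgType k) (x x' : ind N ⊗ R) :
  (forall (S : comAlgType k) (iota : {lrmorphism R -> S}) (y l : gpoint G S),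
     mem_point K y -> mem_point H l ->
     ieval iota (gmul y l) x = ieval iota (gmul y l) x') -> x = x'.
Proof.
move=> e; apply: ieval_inj => S iota g.
have [S' [phi [ff [y [l [Ky Hl E]]]]]] := KH g.
apply: (@tmap_inj_r _ _ _ _ phi); [exact: linearP|exact: ff_inj|].
by rewrite !ieval_nat E; exact: e.
Qed.

(* (ind s)(f)(y l) = l^-1 s(f y), for y in K and l in H, is independent of the
   factorization because two of them differ by a point of H ∩ K, and it defines
   a function on G by descent along the cover over which G = K H. *)
Section Extension.
Context (N N' : gmodule H) (s : N -> N').
Hypothesis hs : ghom (s : res (capG_lel H K) N -> res (capG_lel H K) N').

Let ls : linear s := hs.1.

(** The point c = y'^-1 y = l' l^-1 lies in H ∩ K. Hence f(y) = f(y' c) = c^-1 f(y'), the map s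
    commutes with c^-1, and l^-1 c^-1 = l'^-1. *)
Lemma twist_eq (f : N ⊗ G) (R : comAlgType k) (y l y' l' : gpoint G R) :
  ind_inv f -> mem_point K y -> mem_point H l -> mem_point K y' ->
  mem_point H l' -> gmul y l = gmul y' l' ->
  act (ginv l) (tmap s id (tmap id y f)) =
  act (ginv l') (tmap s id (tmap id y' f)).
Proof.
move=> /ind_invP If Ky Hl Ky' Hl' e; pose c := gmul (ginv y') y.
have cE : c = gmul l' (ginv l).
  by rewrite -[l'](gpKmul y') -e /c -!gpmulA gpmulV gpmul1.
have Hc : mem_point H c by rewrite cE; apply: idl_mul => //; exact: idl_inv.
have Kc : mem_point K c by apply: idl_mul => //; exact: idl_inv.
have HKc : mem_point (capG H K) (ginv c).
  by apply/capG_mem; split; exact: idl_inv.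
have -> : y = gmul y' c by rewrite /c gpVKmul.
rewrite If //.
have -> : ginv l' = gmul (ginv l) (ginv c).
  by rewrite cE gpinvM gpinvK gpmulA gpmulVl gp1mul.
rewrite act_mul; [|exact: idl_inv|exact: idl_inv].
by congr act; exact: hs.2.
Qed.

Lemma ind_ext_ex (f : N ⊗ G) : ind_inv f ->
  exists f' : N' ⊗ G, forall (R : comAlgType k) (y l : gpoint G R),
    mem_point K y -> mem_point H l ->
    tmap id (gmul y l) f' = act (ginv l) (tmap s id (tmap id y f)).
Proof.
move=> If; have [S [phi [ff [x [h [Kx Hh E]]]]]] := KH (idfun : gpoint G G).
have phiE : phi = gmul x h by rewrite -E; exact: lrmorphism_eq.
have twist_nat (R T : comAlgType k) (j : {lrmorphism R -> T})
    (y l : gpoint G R) :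
    mem_point H l -> tmap id j (act (ginv l) (tmap s id (tmap id y f))) =
    act (ginv (gcomp j l)) (tmap s id (tmap id (gcomp j y) f)).
  move=> Hl; rewrite act_gcomp; last exact: idl_inv.
  have lj : linear j by exact: linearP.
  by rewrite gcompV tmap_exchange // tmap_gcomp.
have mem := gcomp_mem.
have [|f' f'E] := tens_descent (ff := ff)
    (w := act (ginv h) (tmap s id (tmap id x f))).
  (* Descent condition: the two pullbacks of (x, h) to S ⊗_{k[G]} S have the same product by
     [push_glue], so [twist_eq] identifies their values. *)
  rewrite !twist_nat //; apply: twist_eq => //; try exact: mem.
  rewrite -!gcompM -phiE; apply: lrmorphism_eq => a.
  exact: (push_glue phi ff a).
exists f' => R y l Ky Hl; pose g : {lrmorphism G -> R} := gmul y l.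
(* To reach an arbitrary point y l over R, compare with the cover: over S ⊗_{k[G]} R the pairs (x,
   h) and (y, l) factor the same point. *)
apply: (@tmap_inj_r _ _ _ _ (push_r g ff)); [exact: linearP|exact: push_r_inj|].
have glue a : push_l g ff (phi a) = push_r g ff (g a) by exact: push_glue.
have -> : tmap id (push_r g ff) (tmap id g f') =
    tmap id (push_l g ff) (tmap id phi f').
  rewrite (tmap_gcomp (G := G)) (tmap_gcomp (G := G)).
  by apply: eq_tmap => // a; rewrite /= glue.
rewrite twist_nat // f'E twist_nat //; apply: twist_eq => //; try exact: mem.
rewrite -!gcompM -phiE; apply: lrmorphism_eq => a.
exact: (push_glue g ff a).
Qed.

(** Locally g = y l, so g h = y (l h) and f'(g h) = (l h)^-1 s(f(y)) = h^-1 f'(g). *)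
Lemma ind_ext_inv (f : N ⊗ G) (f' : N' ⊗ G) : ind_inv f ->
  (forall (R : comAlgType k) (y l : gpoint G R),
    mem_point K y -> mem_point H l ->
    tmap id (gmul y l) f' = act (ginv l) (tmap s id (tmap id y f))) ->
  ind_inv f'.
Proof.
move=> If f'E; apply/ind_invP => R g h Hh.
have [S [phi [ff [y [l [Ky Hl E]]]]]] := KH g.
have Hh' : mem_point H (gcomp phi h) by exact: gcomp_mem.
apply: (@tmap_inj_r _ _ _ _ phi); [exact: linearP|exact: ff_inj|].
rewrite act_gcomp; last exact: idl_inv.
rewrite !tmap_gcomp gcompM gcompV E -gpmulA.
rewrite !f'E //; last exact: idl_mul.
by rewrite gpinvM act_mul //; exact: idl_inv.
Qed.

Lemma ind_ext_spec (f : ind N) : exists f' : ind N',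
  forall (R : comAlgType k) (y l : gpoint G R),
    mem_point K y -> mem_point H l ->
    tmap id (gmul y l) (ival f') =
    act (ginv l) (tmap s id (tmap id y (ival f))).
Proof.
have [f' f'E] := ind_ext_ex (ivalP f).
have [f'' f''E] := ival_ex (ind_ext_inv (ivalP f) f'E).
by exists f''; rewrite f''E.
Qed.

Definition ind_ext (f : ind N) : ind N' := sval (cid (ind_ext_spec f)).

Lemma ind_extE (f : ind N) (R : comAlgType k) (y l : gpoint G R) :
  mem_point K y -> mem_point H l ->
  tmap id (gmul y l) (ival (ind_ext f)) =
  act (ginv l) (tmap s id (tmap id y (ival f))).
Proof. by move=> Ky Hl; rewrite /ind_ext; case: cid => f' /= ->. Qed.

Lemma lin_ind_ext : linear ind_ext.
Proof.
move=> c x y; apply: ival_inj; apply: ind_val_ext => R u l Ku Hl.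
have lul : linear (gmul u l) by exact: linearP.
have lu : linear u by exact: linearP.
have Hl' : mem_point H (ginv l) by exact: idl_inv.
rewrite ind_extE // !lin_ival (lin_tmap (@lin_id _ _) lul) !ind_extE //.
rewrite (lin_tmap (@lin_id _ _) lu) (lin_tmap ls (@lin_id _ _)).
by rewrite (act_lin_k Hl').
Qed.

Lemma ieval_ext_map (R S : comAlgType k) (iota : {lrmorphism R -> S})
    (y l : gpoint G S) (x : ind N ⊗ R) : mem_point K y -> mem_point H l ->
  ieval iota (gmul y l) (tmap ind_ext id x) =
  act (ginv l) (tmap s id (ieval iota y x)).
Proof.
move=> Ky Hl; have Hl' : mem_point H (ginv l) by exact: idl_inv.
have le := lin_ind_ext; move: x; apply: (tens1_ext (c := iota)).
- by apply: lin_comp; [exact: lin_ieval|exact: lin_tmap].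
- apply: (lin_comp (g := act _)); first exact: act_lin_k.
  by apply: lin_comp; [exact: lin_tmap|exact: lin_ieval].
- by move=> r x; rewrite tmap_tscale // ieval_tscale.
- by move=> r x; rewrite ieval_tscale tmap_tscale // act_tscale.
- by move=> f; rewrite tmapE // !ieval1 ind_extE.
Qed.

(** Translation by u in K replaces y l by (u^-1 y) l: only the K-factor changes, and the twist by
    l^-1 is unaffected. *)
Lemma ind_ext_hom :
  ghom (ind_ext : res (le_full K) (ind N) -> res (le_full K) (ind N')).
Proof.
apply: ghom_tens1 => [|R u Ku f]; first exact: lin_ind_ext.
apply: ieval_ext => S iota y l Ky Hl.
have Ku' : mem_point K (gcomp iota (ginv u)) by apply/gcomp_mem/idl_inv.
rewrite ieval_ext_map // [RHS]ieval_act gpmulA.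
rewrite -(tmapE f 1 lin_ind_ext (@lin_id _ R)) ieval_ext_map //.
  by congr (act _ (tmap _ _ _)); exact: ieval_act.
exact: idl_mul.
Qed.

End Extension.

End EquivariantFunctoriality.

(** * Submodules and direct summands *)

Section TensorSubspaces.
Context (k : fieldType).
Implicit Types V R : lmodType k.

Lemma tens_sub_ext V R (P : lmodType k) (W : V -> Prop) (f g : V ⊗ R -> P) z :
  linear f -> linear g ->
  (forall w r, W w -> f (tens w r) = g (tens w r)) -> tens_sub W z -> f z = g z.
Proof.
move=> lf lg e [s [sW ->]]; rewrite !lin_sum //; apply: eq_big_seq => p ps.
exact/e/sW.
Qed.

Lemma tens_sub_mono V R (W U : V -> Prop) (z : V ⊗ R) :
  (forall x, W x -> U x) -> tens_sub W z -> tens_sub U z.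
Proof. by move=> WU [s [sW ->]]; exists s; split=> // p /sW/WU. Qed.

Lemma tens_sub_contractP V R (W : V -> Prop) (z : V ⊗ R) alpha :
  subspace W -> linear alpha -> tens_sub W z -> W (contract alpha z).
Proof.
move=> sW la [s [sWs ->]]; rewrite (lin_sum _ _ (lin_contract la)).
elim: s sWs => [|p s IH] h; first by rewrite big_nil; exact: sW.1.
rewrite big_cons contractE //; apply: sW.2; first by apply: h; rewrite mem_head.
by apply: IH => q qs; apply: h; rewrite in_cons qs orbT.
Qed.

(** A tensor lies in W ⊗ R exactly when its contractions by all functionals on R lie in W, and this
    criterion respects intersections. *)
Lemma tens_sub_cap V R (W U : V -> Prop) (z : V ⊗ R) :
  subspace W -> subspace U -> tens_sub W z -> tens_sub U z ->
  tens_sub (fun x => W x /\ U x) z.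
Proof.
move=> sW sU zW zU; apply: tens_sub_contract => [|alpha la].
  split=> [|c x y [Wx Ux] [Wy Uy]]; first by split; [exact: sW.1|exact: sU.1].
  by split; [exact: sW.2|exact: sU.2].
by split; exact: tens_sub_contractP.
Qed.

Lemma tens_sub_map V (U : lmodType k) R (f : V -> U) (W : V -> Prop)
    (W' : U -> Prop) (z : V ⊗ R) : linear f -> (forall x, W x -> W' (f x)) ->
  tens_sub W z -> tens_sub W' (tmap f id z).
Proof.
move=> lf WW' [s [sW ->]]; exists [seq (f p.1, p.2) | p <- s]; split.
  by move=> _ /mapP[p /sW/WW' Wp ->].
rewrite (lin_sum _ _ (lin_tmap lf (@lin_id _ _))) big_map.
by apply: eq_bigr => p _; rewrite tmapE.
Qed.

Lemma tens_subT V R (z : V ⊗ R) : tens_sub (fun=> True) z.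
Proof. by exists (tens_repr z); split=> //; exact: tens_sum. Qed.

Lemma tens_sub_ker V (U : lmodType k) R (f : V -> U) (z : V ⊗ R) : linear f ->
  tens_sub (fun x => f x = 0) z <-> tmap f id z = 0.
Proof.
move=> lf; split.
  apply: tens_sub_ext => [||w r fw].
  - exact: lin_tmap.
  - by move=> c x y; rewrite scaler0 addr0.
  - by rewrite tmapE // fw (lin0 (@lin_tensl _ _ _ r)).
move=> z0; apply: tens_sub_contract => [|alpha la].
  split=> [|c x y fx fy]; first exact: lin0.
  by rewrite lf fx fy scaler0 addr0.
by rewrite -tmap_contract // z0 (lin0 (lin_contract la)).
Qed.

Lemma tens_sub_tscale V (A : comAlgType k) (W : V -> Prop) (a : A) (z : V ⊗ A) :
  tens_sub W z -> tens_sub W (tscale a z).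
Proof.
move=> [s [sW ->]]; exists [seq (p.1, a * p.2) | p <- s]; split.
  by move=> _ /mapP[p /sW Wp ->].
rewrite (lin_sum _ _ (lin_tscale a)) big_map.
by apply: eq_bigr => p _; rewrite tscaleE.
Qed.

End TensorSubspaces.

Section Submodules.
Context (k : fieldType) (G : algGroup k).
Implicit Types H : closedSubgroup G.

Lemma gsubmod_tens1 H (M : gmodule H) (W : M -> Prop) : subspace W ->
  (forall (R : comAlgType k) (g : gpoint G R), mem_point H g ->
     forall w, W w -> tens_sub W (act g (tens w 1))) -> gsubmod W.
Proof.
move=> sW e; split=> // R g Hg z [s [sWs ->]].
rewrite (lin_sum _ _ (act_lin_k Hg)).
elim: s sWs => [|p s IH] h.
  by rewrite big_nil; exact: (tens_sub_subspace R sW).1.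
rewrite big_cons; apply: (subspD (tens_sub_subspace R sW)).
  rewrite tens_tscale act_tscale //; apply/tens_sub_tscale/e => //.
  by apply: h; rewrite mem_head.
by apply: IH => q qs; apply: h; rewrite in_cons qs orbT.
Qed.

Lemma gsubmod0 H (M : gmodule H) : gsubmod (fun x : M => x = 0).
Proof.
apply: gsubmod_tens1 => [|R g Hg w ->].
  by split=> // c x y -> ->; rewrite scaler0 addr0.
rewrite (lin0 (@lin_tensl _ _ _ _)) (lin0 (act_lin_k Hg)).
by exists [::]; rewrite big_nil.
Qed.

Lemma gsubmodT H (M : gmodule H) : gsubmod (fun _ : M => True).
Proof. by split=> // R g Hg z _; exact: tens_subT. Qed.

Lemma gsubmod_ker H (M N : gmodule H) (f : M -> N) :
  ghom f -> gsubmod (fun x => f x = 0).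
Proof.
move=> [lf hf]; split=> [|R g Hg z].
  split=> [|c x y fx fy]; first exact: lin0.
  by rewrite lf fx fy scaler0 addr0.
move=> /tens_sub_ker - /(_ lf) z0; apply/tens_sub_ker => //.
by rewrite hf // z0 (lin0 (act_lin_k Hg)).
Qed.

Lemma gsubmod_im H (M N : gmodule H) (f : M -> N) :
  ghom f -> gsubmod (fun y => exists x, f x = y).
Proof.
move=> [lf hf]; apply: gsubmod_tens1 => [|R g Hg _ [x <-]].
  split=> [|c _ _ [x <-] [y <-]]; first by exists 0; exact: lin0.
  by exists (c *: x + y); exact: lf.
rewrite -(tmapE x 1 lf (@lin_id _ R)) -hf //.
by apply: tens_sub_map (tens_subT _) => // y _; exists y.
Qed.

Lemma gsubmod_cap H (M : gmodule H) (W U : M -> Prop) :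
  gsubmod W -> gsubmod U -> gsubmod (fun x => W x /\ U x).
Proof.
move=> [sW gW] [sU gU]; split=> [|R g Hg z zWU].
  split=> [|c x y [Wx Ux] [Wy Uy]]; first by split; [exact: sW.1|exact: sU.1].
  by split; [exact: sW.2|exact: sU.2].
by apply: tens_sub_cap => //; [apply: gW|apply: gU] => //;
  apply: tens_sub_mono zWU => x [].
Qed.

Lemma gsubmod_add H (M : gmodule H) (W U : M -> Prop) :
  gsubmod W -> gsubmod U ->
  gsubmod (fun x => exists w u, [/\ W w, U u & x = w + u]).
Proof.
move=> [sW gW] [sU gU].
have sWU : subspace (fun x => exists w u, [/\ W w, U u & x = w + u]).
  split=> [|c _ _ [w [u [Ww Uu ->]]] [w' [u' [Ww' Uu' ->]]]].
    by exists 0, 0; rewrite addr0; split=> //; [exact: sW.1|exact: sU.1].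
  exists (c *: w + w'), (c *: u + u').
  by rewrite scalerDr addrACA; split=> //; [exact: sW.2|exact: sU.2].
apply: gsubmod_tens1 => // R g Hg _ [w [u [Ww Uu ->]]].
rewrite (linD _ _ (@lin_tensl _ _ _ 1)) (linD _ _ (act_lin_k Hg)).
apply: (subspD (tens_sub_subspace R sWU)).
  apply: (tens_sub_mono (W := W)) => [x Wx|].
    by exists x, 0; rewrite addr0; split=> //; exact: sU.1.
  by apply: gW => //; exact: tens_sub_tens.
apply: (tens_sub_mono (W := U)) => [x Ux|].
  by exists 0, x; rewrite add0r; split=> //; exact: sW.1.
by apply: gU => //; exact: tens_sub_tens.
Qed.

(** Submodules are predicates, whereas relative injectivity speaks of modules; this passes from the
    former to the latter. *)
Lemma submodule_ex H (M : gmodule H) (W : M -> Prop) : gsubmod W ->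
  exists (P : gmodule H) (i : P -> M),
    [/\ ghom i, injective i & forall x, W x <-> exists p, i p = x].
Proof.
move=> [sW gW]; pose P : lmodType k := subsp sW.
pose incl (R : comAlgType k) : P ⊗ R -> M ⊗ R := tmap (fun p : P => val p) id.
have lval : linear (fun p : P => val p : M) by [].
have li R : linear (incl R) by exact: lin_tmap.
have injI R : injective (incl R) by apply: tmap_inj => //; exact: val_inj.
have subI R x : tens_sub W (incl R x).
  apply: tens_sub_map (tens_subT x) => // -[p pW] _.
  exact/(subsp_predP sW).
have inclP R z : tens_sub W z -> exists x, incl R x = z.
  move=> [s [hs ->]]; elim: s hs => [|p s IH] hs.
    by exists 0; rewrite big_nil (lin0 (li R)).
  have [|x xE] := IH; first by move=> q qs; apply: hs; rewrite in_cons qs orbT.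
  have /(subsp_predP sW) Wp : W p.1 by apply: hs; rewrite mem_head.
  exists (tens (Subsp Wp : P) p.2 + x).
  by rewrite (linD _ _ (li R)) xE big_cons /incl tmapE.
have ex (R : comAlgType k) (g : gpoint G R) (x : P ⊗ R) :
    exists y, mem_point H g -> incl R y = act g (incl R x).
  (* [act] is a total function; outside H(R) the value 0 is a default. *)
  have [Hg|nHg] := pselect (mem_point H g); last by exists 0.
  by have [y yE] := inclP R _ (gW R g Hg _ (subI R x)); exists y.
pose a (R : comAlgType k) (g : gpoint G R) x := sval (cid (ex R g x)).
have aP (R : comAlgType k) (g : gpoint G R) x :
    mem_point H g -> incl R (a R g x) = act g (incl R x).
  by move=> Hg; rewrite /a; case: cid => y /= ->.
have inclZ (R : comAlgType k) r x : incl R (tscale r x) = tscale r (incl R x).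
  by apply: tmap_tscale.
have incl_nat (R S : comAlgType k) (phi : {lrmorphism R -> S}) x :
    tmap id phi (incl R x) = incl S (tmap id phi x).
  by rewrite /incl tmap_exchange //; exact: linearP.
unshelve eexists (@GModule k G H P a _ _ _ _), (fun p : P => val p).
- move=> R g Hg r x y; apply: injI.
  by rewrite aP // !(linD _ _ (li R)) !inclZ !aP // act_lin.
- by move=> R x; apply: injI; rewrite aP ?act_one //; exact: idl_one.
- move=> R g h Hg Hh x; apply: injI; rewrite !aP ?act_mul //.
  exact: idl_mul.
- move=> R S phi g g' Hg e x; apply: injI.
  have Hg' : mem_point H g' by move=> b Hb; rewrite e Hg // raddf0.
  by rewrite -incl_nat !aP // -incl_nat; exact: act_nat.
split=> [||x].
- by split=> // R g Hg x; exact: (aP R g x Hg).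
- exact: val_inj.
- split=> [/(subsp_predP sW) Wx|[[p pW] <-]]; first by exists (Subsp Wx).
  exact/(subsp_predP sW).
Qed.

End Submodules.

Section Summands.
Context (k : fieldType) (G : algGroup k) (C : closedSubgroup G).
Implicit Types M N : gmodule C.

(** The map t g is idempotent with the same kernel as g. The complement is its image, written as the
    kernel of 1 - t g so that it is a submodule by [gsubmod_ker]. *)
Lemma is_summand_ker M N (g : M -> N) (t : N -> M) :
  ghom g -> ghom t -> (forall x, g (t (g x)) = g x) ->
  is_summand (fun x => g x = 0).
Proof.
move=> hg ht gtg; split; first exact: gsubmod_ker.
exists (fun x => x - t (g x) = 0); split.
- by apply: gsubmod_ker; apply: ghom_sub; [exact: ghom_id|exact: ghom_comp].
- move=> x; exists (x - t (g x)), (t (g x)); rewrite gtg subrr subrK.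
  split=> //; rewrite (linD _ _ hg.1) -scaleN1r (linZ _ _ hg.1) scaleN1r gtg.
  exact: subrr.
- by move=> x ->; rewrite (lin0 ht.1) subr0.
Qed.

Lemma is_summand0 M : is_summand (fun x : M => x = 0).
Proof.
split; first exact: gsubmod0.
exists (fun=> True); split=> // [|x]; first exact: gsubmodT.
by exists 0, x; rewrite add0r.
Qed.

Lemma is_summand_ext M (W W' : M -> Prop) :
  (forall x, W x <-> W' x) -> is_summand W -> is_summand W'.
Proof. by move=> e; have -> : W = W' by apply/funext => x; exact/propext. Qed.

(* If N = g(M) ⊕ V and M = Ker g ⊕ U, the quasi-inverse is the inverse of
   U -> g(M), extended by 0 on V. *)
Lemma quasi_inverse_ex M N (g : M -> N) : ghom g ->
  is_summand (fun x => g x = 0) -> is_summand (fun y => exists x, g x = y) ->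
  exists t : N -> M, ghom t /\ forall x, g (t (g x)) = g x.
Proof.
move=> hg [gK [U [gU KU KU0]]] [gI [V [gV IV IV0]]].
have [lg eg] := hg; have [sU aU] := gU; have [sV aV] := gV.
have ex n : exists u, U u /\ V (n - g u).
  have [_ [v [[x <-] Vv ->]]] := IV n; have [w [u [gw Uu ->]]] := KU x.
  by exists u; rewrite (linD _ _ lg) gw add0r addrAC subrr add0r.
have uniq_u n u u' : U u -> U u' -> V (n - g u) -> V (n - g u') -> u = u'.
  move=> Uu Uu' Vu Vu'; apply/eqP; rewrite -subr_eq0; apply/eqP.
  have dE : u - u' = -1 *: u' + u by rewrite scaleN1r addrC.
  apply: KU0; last by rewrite dE; exact: sU.2.
  apply: IV0; first by exists (u - u').
  have -> : g (u - u') = -1 *: (n - g u) + (n - g u').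
    by rewrite dE lg !scaleN1r opprB addrA subrK addrC.
  exact: sV.2.
pose t n := sval (cid (ex n)).
have tP n : U (t n) /\ V (n - g (t n)) by rewrite /t; case: cid.
have tE n u : U u -> V (n - g u) -> t n = u.
  by move=> Uu Vu; have [? ?] := tP n; apply: uniq_u Vu.
have tg u : U u -> t (g u) = u.
  by move=> Uu; apply: tE => //; rewrite subrr; exact: sV.1.
have tV v : V v -> t v = 0.
  by move=> Vv; apply: tE; [exact: sU.1|rewrite (lin0 lg) subr0].
have lt : linear t.
  move=> c x y; have [Ux Vx] := tP x; have [Uy Vy] := tP y.
  apply: tE; first exact: sU.2.
  by rewrite lg opprD addrACA -scalerBr; exact: sV.2.
exists t; split; last first.
  move=> x; have [w [u [gw Uu ->]]] := KU x.
  by rewrite (linD _ _ lg) gw add0r tg.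
(* Split n as (n - g u) + g u: c keeps the first part in V ⊗ R, which t kills, and keeps u in U ⊗ R,
   where t inverts g. *)
apply: ghom_tens1 => // R c Cc n; have [Uu Vv] := tP n.
set u := t n in Uu Vv *; rewrite -[n in LHS](subrK (g u)).
rewrite (linD _ _ (@lin_tensl _ _ _ 1)) (linD _ _ (act_lin_k Cc)).
have ltm : linear (tmap t id : N ⊗ R -> M ⊗ R) by exact: lin_tmap.
rewrite (linD _ _ ltm).
have -> : tmap t id (act c (tens (n - g u) 1)) = 0.
  apply: (tens_sub_ext (W := V) (g := fun=> 0)) => //.
  - by move=> d x y; rewrite scaler0 addr0.
  - by move=> v r Vv'; rewrite tmapE // tV // (lin0 (@lin_tensl _ _ _ r)).
  - by apply: aV => //; exact: tens_sub_tens.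
rewrite add0r -(tmapE u 1 lg (@lin_id _ R)) -eg //.
apply: (tens_sub_ext (W := U) (f := fun z => tmap t id (tmap g id z))
  (g := id)).
- by apply: lin_comp; first exact: ltm; exact: lin_tmap.
- exact: lin_id.
- by move=> v r Uv; rewrite !tmapE // tg.
- by apply: aU => //; exact: tens_sub_tens.
Qed.

(* U is maximal among the submodules meeting W trivially; a simple W_i not
   contained in W + U meets it trivially, so U + W_i contradicts maximality. *)
Lemma semisimple_summand M (W : M -> Prop) :
  semisimple M -> gsubmod W -> is_summand W.
Proof.
move=> [I [S [simS sumS _]]] gW; split=> //; have [sW aW] := gW.
(* Zorn's lemma is also applied to the empty chain, whose union is empty; adjoining 0 makes that the
   zero submodule. *)
pose add0 (X : set M) x := X x \/ x = 0.
pose PP (X : set M) := gsubmod (add0 X) /\ forall x, W x -> X x -> x = 0.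
have [F FP Ftot|X [[gX WX0] Xmax]] := @Zorn_bigcup M PP.
  split; last by move=> x Wx [X FX Xx]; exact: (FP _ FX).2.
  have up (X : set M) x :
      F X -> add0 X x -> add0 (\bigcup_(Y in F) Y)%classic x.
    by move=> FX [Xx|->]; [left; exists X|right].
  have get (x : M) :
      add0 (\bigcup_(Y in F) Y)%classic x -> x = 0 \/ exists2 X, F X & X x.
    by case=> [[X FX Xx]|]; [right; exists X|left].
  apply: gsubmod_tens1 => [|R g Hg w /get[->|[X FX Xw]]].
  - split=> [|c x y /get[->|[X FX Xx]] /get[->|[Y FY Yy]]]; first by right.
    + by rewrite scaler0 addr0; right.
    + rewrite scaler0 add0r; apply: (up _ _ FY); by left.
    + rewrite addr0; apply: (up _ _ FX).
      have [[s _] _] := FP _ FX; have [s0 sX] := s.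
      by rewrite -[_ *: _]addr0; apply: sX; [left|right].
    + have [XY|YX] := Ftot _ _ FX FY.
        apply: (up _ _ FY); have [[[_ sY] _] _] := FP _ FY.
        by apply: sY; left; first exact: XY.
      apply: (up _ _ FX); have [[[_ sX] _] _] := FP _ FX.
      by apply: sX; left; last exact: YX.
  - have [s0 _] := gsubmod0 M.
    rewrite (lin0 (@lin_tensl _ _ _ _)) (lin0 (act_lin_k Hg)).
    by exists [::]; rewrite big_nil.
  - apply: (tens_sub_mono (W := add0 X)) => [x|]; first exact: up.
    have [[_ aX] _] := FP _ FX; apply: aX => //.
    by apply: tens_sub_tens; left.
pose U := add0 X; exists U.
have WU0 x : W x -> U x -> x = 0 by move=> Wx [Xx|//]; exact: WX0.
pose WU x := exists w u, [/\ W w, U u & x = w + u].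
have gWU : gsubmod WU by exact: gsubmod_add.
have UWU x : U x -> WU x.
  by move=> Ux; exists 0, x; rewrite add0r; split=> //; exact: sW.1.
have SWU i x : S i x -> WU x.
  have [gS _ simp] := simS i.
  have [S0|SS] := simp (fun x => S i x /\ WU x) (gsubmod_cap gS gWU)
    (fun x h => h.1).
    2: by move=> /SS[].
  pose Y x := exists u s, [/\ U u, S i s & x = u + s].
  have gY : gsubmod Y by exact: gsubmod_add.
  have Y0E : add0 Y = Y.
    apply/funext => y; apply/propext; split=> [[//|->]|Yy]; last by left.
    exact: gY.1.1.
  have UY y : U y -> Y y.
    by move=> Uy; exists y, 0; rewrite addr0; split=> //; exact: gS.1.1.
  have PY : PP Y.
    split; first by rewrite Y0E.
    move=> y Wy [u [s [Uu Ss yE]]].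
    have s0 : s = 0.
      apply: S0; split=> //; exists y, (- u); split=> //.
        exact: (subspN gX.1).
      by rewrite yE addrAC subrr add0r.
    by rewrite yE s0 addr0 in Wy *; exact: WU0.
  move=> Sx; have Yx : Y x.
    by exists 0, x; rewrite add0r; split=> //; exact: gX.1.1.
  have [Xx|nXx] := pselect (X x); first by apply: UWU; left.
  exfalso; apply: (Xmax Y) PY; split; first by move=> y Xy; apply: UY; left.
  by move=> YX; apply: nXx; exact: YX.
split=> //.
move=> x; have [s [y [Sy ->]]] := sumS x.
elim: s => [|i s IH]; first by rewrite big_nil; exact: gWU.1.1.
by rewrite big_cons; apply: (subspD gWU.1) => //; exact: SWU (Sy i).
Qed.

End Summands.

(** * Induction of resolutions *)

Section InducedExactness.
Context (k : fieldType) (G : algGroup k).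
Implicit Types H K : closedSubgroup G.

Lemma is_summand_res L K (LK : subgroup_le L K) (M : gmodule K)
    (W : M -> Prop) :
  is_summand W -> is_summand (M := res LK M) W.
Proof.
have gres (X : M -> Prop) : gsubmod X -> gsubmod (M := res LK M) X.
  by move=> [sX aX]; split=> // R g Lg; apply: aX; exact: mem_le Lg.
move=> [gW [U [gU s0 s1]]]; split; first exact: gres.
by exists U; split=> //; exact: gres.
Qed.

Lemma ival_ext H (N : gmodule H) (f f' : ind N) :
  (forall (R : comAlgType k) (g : gpoint G R),
     tmap id g (ival f) = tmap id g (ival f')) -> f = f'.
Proof.
move=> e; apply: ival_inj; rewrite -[LHS]tmap_id -[RHS]tmap_id.
exact: (e _ (idfun : gpoint G G)).
Qed.

Lemma ind_map_eq0 H (M N : gmodule H) (g : M -> N) (hg : ghom g)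
    (f : ind M) (R : comAlgType k) (y : gpoint G R) :
  ind_map hg f = 0 -> tmap g id (tmap id y (ival f)) = 0.
Proof.
move=> e; rewrite -(ind_map_val hg) e (lin0 (@lin_ival k G H N)).
by rewrite (lin0 (lin_tmap (@lin_id _ _) _)) //; exact: linearP.
Qed.

Section QuasiInverses.
Context (H K : closedSubgroup G) (KH : ff_product H K).
Context (L M N : gmodule H) (f : L -> M) (g : M -> N).
Context (hf : ghom f) (hg : ghom g).
Context (s : M -> L) (t : N -> M).
Hypothesis hs : ghom (s : res (capG_lel H K) M -> res (capG_lel H K) L).
Hypothesis ht : ghom (t : res (capG_lel H K) N -> res (capG_lel H K) M).

(** Here s supplies preimages, since f s is the identity on Ker g = f(L), and t supplies the
    K-equivariant splitting. The identities are checked at points y l, where the H-maps f and g pass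
    through the twist by l^-1. *)
Lemma ind_exact_of_quasi_inverses : exact_pair f g ->
  (forall x, f (s (f x)) = f x) -> (forall x, g (t (g x)) = g x) ->
  rel_exact_at (le_full K) (ind_map hf) (ind_map hg).
Proof.
move=> ex fsf gtg.
have [lf _] := hf; have [lg _] := hg; have ls : linear s := hs.1.
have lt : linear t := ht.1.
have inv (P : gmodule H) (p : ind P) (R : comAlgType k) (y l : gpoint G R) :
    mem_point H l ->
    tmap id (gmul y l) (ival p) = act (ginv l) (tmap id y (ival p)).
  by move=> Hl; have /ind_invP -> := ivalP p.
split; last first.
  apply: (is_summand_ker (M := res (le_full K) (ind M))
    (N := res (le_full K) (ind N)) (t := ind_ext KH ht)).
  - exact/ghom_res/ind_map_hom.
  - exact: ind_ext_hom.
  move=> p; apply: ival_inj; apply: (ind_val_ext KH) => R y l Ky Hl.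
  have Hl' : mem_point H (ginv l) by exact: idl_inv.
  rewrite [LHS]ind_map_val ind_extE // ind_map_val hg.2 // !tmap_compl //;
    try by do ?exact: lin_comp.
  rewrite (eq_tmap (f' := g) (g' := id)) // -ind_map_val.
  by rewrite [RHS]inv.
move=> p; split=> [p0|[q <-]]; last first.
  apply: ival_ext => R y; rewrite !ind_map_val tmap_compl //.
  have ly : linear y by exact: linearP.
  rewrite (lin0 (@lin_ival k G H N)) (lin0 (lin_tmap (@lin_id _ _) ly)).
  have gf0 : (fun x => g (f x)) =1 0 by move=> x; apply/ex; exists x.
  by rewrite (eq_tmap (f' := 0) (g' := id)) // tmap0l.
exists (ind_ext KH hs p); apply: ival_inj.
apply: (ind_val_ext KH) => R y l Ky Hl.
have Hl' : mem_point H (ginv l) by exact: idl_inv.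
rewrite ind_map_val ind_extE // hf.2 // inv //; congr act.
(* Over a field, kernels commute with ⊗ R, so the values of p lie in Ker g ⊗ R. *)
have := ind_map_eq0 y p0; move/tens_sub_ker => /(_ lg) pK.
apply: (tens_sub_ext (f := fun z => tmap f id (tmap s id z)) (g := id)) pK.
- by apply: lin_comp; exact: lin_tmap.
- exact: lin_id.
- by move=> m r /ex[x <-]; rewrite !tmapE // fsf.
Qed.

End QuasiInverses.

Section Cases.
Context (H K : closedSubgroup G).
Hypothesis HK : product_is_full H K \/ Mod_semisimple H.

(* In the semisimple case everything splits over H = H ∩ G, and the argument
   for HK = G applies with G in place of K. *)
Lemma ind_exact (L M N : gmodule H) (f : L -> M) (g : M -> N)
    (hf : ghom f) (hg : ghom g) :
  rel_exact_at (capG_lel H K) f g ->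
  is_summand (M := res (capG_lel H K) L) (fun x => f x = 0) ->
  is_summand (M := res (capG_lel H K) N) (fun z => exists y, g y = z) ->
  rel_exact_at (le_full K) (ind_map hf) (ind_map hg).
Proof.
move=> [ex sg] sf sI; case: HK => [/product_is_full_ff KH|ss].
  have sfI : is_summand (M := res (capG_lel H K) M)
      (fun y => exists x, f x = y).
    by apply: is_summand_ext sg => y; exact: ex.
  have [s [hs fsf]] := quasi_inverse_ex (ghom_res (capG_lel H K) hf) sf sfI.
  have [t [ht gtg]] := quasi_inverse_ex (ghom_res (capG_lel H K) hg) sg sI.
  exact: (ind_exact_of_quasi_inverses KH hf hg hs ht).
have ssS (P : gmodule H) (W : P -> Prop) : gsubmod W -> is_summand W.
  exact/semisimple_summand/ss.
have [s [hs fsf]] := quasi_inverse_ex hf (ssS _ _ (gsubmod_ker hf))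
  (ssS _ _ (gsubmod_im hf)).
have [t [ht gtg]] := quasi_inverse_ex hg (ssS _ _ (gsubmod_ker hg))
  (ssS _ _ (gsubmod_im hg)).
have [exI sI'] := ind_exact_of_quasi_inverses (ff_product_fullG H) hf hg
  (ghom_res _ hs) (ghom_res _ ht) ex fsf gtg.
by split=> //; exact: is_summand_res sI'.
Qed.

End Cases.

Lemma ind_injective H K (I : gmodule H) :
  rel_injective (capG_lel H K) I -> rel_injective (le_full K) (ind I).
Proof.
move=> injI M1 M2 M3 d1 d2 h1 h2 [inj1 [ex sd2] surj2] f hf.
have hf' : ghom ((fun x => ind_counit (f x)) : res (le_full H) M1 -> I).
  apply: (ghom_comp (N := res (le_full H) (ind I))).
    exact: ghom_res hf.
  exact: ind_counit_hom.
have [|h [hh hE]] := injI _ _ _ _ _ (ghom_res (le_full H) h1)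
    (ghom_res (le_full H) h2) _ _ hf'.
  split=> //; split=> //; exact: (is_summand_res (capG_ler H K) sd2).
exists (transpose hh); split; first exact: transpose_hom.
apply: ind_hom_eq => // [|m]; first exact: ghom_comp h1 (transpose_hom hh).
by rewrite transposeK hE.
Qed.

(** Left transparent: the comparison of complexes relies on its terms and differentials unfolding to
    [ind] and [ind_map]. *)
Definition ind_resolution H K (HK : product_is_full H K \/ Mod_semisimple H)
    (N : gmodule H) (RH : rel_resolution (capG_lel H K) N) :
  rel_resolution (le_full K) (ind N).
Proof.
refine (@RelResolution k G (fullG G) K (le_full K) (ind N)
  (fun i => ind (rterm RH i)) (ind_map (raug_hom RH))
  (fun i => ind_map (rdiff_hom RH i)) _ _ _ _ _ _).
- exact: ind_map_hom.
- by move=> i; exact: ind_map_hom.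
- move=> p p0; apply: ival_ext => R y.
  have lr : linear (raug RH) := (raug_hom RH).1.
  have ir : injective (raug RH).
    move=> x x' e; apply/eqP; rewrite -subr_eq0; apply/eqP/(raug_inj (r := RH)).
    by rewrite -scaleN1r addrC lr scaleN1r e addNr.
  apply: (tmap_inj lr ir); rewrite (ind_map_eq0 y p0).
  have ly : linear y by exact: linearP.
  rewrite (lin0 (@lin_ival k G H N)) (lin0 (lin_tmap (@lin_id _ _) ly)).
  by rewrite (lin0 (lin_tmap lr (@lin_id _ _))).
- apply: ind_exact => //; first exact: rexact0.
    apply: is_summand_ext (is_summand0 _) => x.
    by split=> [->|/raug_inj //]; exact: (lin0 (raug_hom RH).1).
  have [_ s1] := rexactS RH 0; apply: is_summand_ext s1 => z.
  exact: (rexactS RH 0).1.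
- move=> i; apply: ind_exact => //; first exact: rexactS.
    (* The kernel of [rdiff i] is governed by exactness at term i, which is [rexact0] for i = 0 and
       [rexactS] at i - 1 otherwise. *)
    case: i => [|i]; first exact: (rexact0 RH).2.
    exact: (rexactS RH i).2.
  have [_ s1] := rexactS RH i.+1; apply: is_summand_ext s1 => z.
  exact: (rexactS RH i.+1).1.
- by move=> i; apply/ind_injective/rterm_inj.
Defined.

End InducedExactness.

(** * Independence of the resolution *)

Section Comparison.
Context (k : fieldType) (G : algGroup k).

Lemma ghom_factor_inj (A : closedSubgroup G) (P V W : gmodule A)
    (i : P -> W) (g : V -> W) :
  ghom i -> injective i -> ghom g -> (forall v, exists p, i p = g v) ->
  exists d : V -> P, ghom d /\ forall v, i (d v) = g v.
Proof.
move=> hi inji hg ex; have [li ei] := hi; have [lg eg] := hg.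
pose d v := sval (cid (ex v)).
have dE v : i (d v) = g v by rewrite /d; case: cid.
have ld : linear d by move=> c x y; apply: inji; rewrite li !dE lg.
exists d; split=> //; split=> // R u Hu x; apply: (tmap_inj li inji).
have idE z : tmap i id (tmap d id z) = tmap g id z :> W ⊗ R.
  by rewrite tmap_compl //; apply: eq_tmap.
by rewrite idE ei // idE eg.
Qed.

Lemma ghom_factor_surj (A : closedSubgroup G) (U P I : gmodule A)
    (f : U -> P) (phi : U -> I) :
  ghom f -> (forall p, exists u, f u = p) -> ghom phi ->
  (forall x, f x = 0 -> phi x = 0) ->
  exists psi : P -> I, ghom psi /\ forall u, psi (f u) = phi u.
Proof.
move=> [lf ef] ex [lp ep] ker.
pose psi p := phi (sval (cid (ex p))).
have psiE u : psi (f u) = phi u.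
  rewrite /psi; case: cid => u' /= e; apply/eqP; rewrite -subr_eq0; apply/eqP.
  rewrite addrC -scaleN1r -lp; apply: ker.
  by rewrite lf scaleN1r e addNr.
have lpsi : linear psi.
  move=> c p q; have [u <-] := ex p; have [v <-] := ex q.
  by rewrite -lf !psiE lp.
exists psi; split=> //; apply: ghom_tens1 => // R g Ag p; have [u <-] := ex p.
rewrite -(tmapE u 1 lf (@lin_id _ R)) -ef // tmap_compl //.
rewrite (eq_tmap (f' := phi) (g' := id)) ?ep ?tmapE ?psiE //; exact: psiE.
Qed.

Context (A C : closedSubgroup G) (CA : subgroup_le C A).

(** Injectivity concerns short exact sequences, so it is applied to 0 -> f(U) -> V -> g(V) -> 0,
    through which f, g and phi factor. Both chain maps and homotopies are built from this. *)
Lemma extend_along (U V W I : gmodule A) (f : U -> V) (g : V -> W)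
    (phi : U -> I) :
  ghom f -> ghom g -> rel_exact_at CA f g -> rel_injective CA I -> ghom phi ->
  (forall x, f x = 0 -> phi x = 0) ->
  exists psi : V -> I, ghom psi /\ forall x, psi (f x) = phi x.
Proof.
move=> hf hg [ex sg] injI hphi ker.
have [P1 [i1 [hi1 inj1 im1]]] := submodule_ex (gsubmod_im hf).
have [P3 [i3 [hi3 inj3 im3]]] := submodule_ex (gsubmod_im hg).
have [|f1 [hf1 f1E]] := ghom_factor_inj hi1 inj1 hf.
  by move=> u; apply/im1; exists u.
have [|g3 [hg3 g3E]] := ghom_factor_inj hi3 inj3 hg.
  by move=> v; apply/im3; exists v.
have i10 := lin0 hi1.1; have i30 := lin0 hi3.1.
have [||psi1 [hpsi1 psi1E]] := ghom_factor_surj hf1 _ hphi.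
- move=> p; have [|u uE] := (im1 (i1 p)).2; first by exists p.
  by exists u; apply: inj1; rewrite f1E.
- by move=> x x0; apply: ker; rewrite -f1E x0.
have kerE v : g3 v = 0 <-> g v = 0.
  rewrite -g3E; split=> [->//|e]; apply: inj3; by rewrite e i30.
have [|h [hh hE]] := injI _ _ _ _ _ hi1 hg3 _ _ hpsi1.
  split=> [x x0||z].
  - by apply: inj1; rewrite x0.
  - split=> [v|].
      rewrite kerE -im1; exact: ex.
    by apply: is_summand_ext sg => v; rewrite kerE.
  - have [|v vE] := (im3 (i3 z)).2; first by exists z.
    by exists v; apply: inj3; rewrite g3E.
by exists h; split=> // x; rewrite -f1E -hE psi1E.
Qed.

Lemma dependent_choice_seq (T : nat -> Type)
    (r : forall i, T i -> T i.+1 -> Prop) :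
  (forall i a, exists b, r i a b) -> forall a0 : T 0%N,
  exists s : forall i, T i, s 0%N = a0 /\ forall i, r i (s i) (s i.+1).
Proof.
move=> ex a0.
pose s := nat_rect T a0 (fun i a => sval (cid (ex i a))).
by exists s; split=> // i; rewrite /s /=; case: cid.
Qed.

Lemma rdiff_raug (N : gmodule A) (R : rel_resolution CA N) x :
  rdiff R 0 (raug R x) = 0.
Proof. by apply/(rexact0 R).1; exists x. Qed.

Lemma rdiff_rdiff (N : gmodule A) (R : rel_resolution CA N) i x :
  rdiff R i.+1 (rdiff R i x) = 0.
Proof. by apply/(rexactS R i).1; exists x. Qed.

Definition chain_map (N : gmodule A) (R1 R2 : rel_resolution CA N)
    (a : forall i, rterm R1 i -> rterm R2 i) : Prop :=
  [/\ forall i, ghom (a i), forall x, a 0%N (raug R1 x) = raug R2 x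
    & forall i x, a i.+1 (rdiff R1 i x) = rdiff R2 i (a i x)].

(** The recursion carries the invariant that d a_i vanishes on Ker d, which is what [extend_along]
    needs to produce the next map. *)
Lemma chain_map_ex (N : gmodule A) (R1 R2 : rel_resolution CA N) :
  exists a, chain_map (R1 := R1) (R2 := R2) a.
Proof.
pose T i := {a : rterm R1 i -> rterm R2 i |
  ghom a /\ forall x, rdiff R1 i x = 0 -> rdiff R2 i (a x) = 0}.
have [|a0 [ha0 a0E]] := extend_along (raug_hom R1) (rdiff_hom R1 0) (rexact0 R1)
  (rterm_inj (r := R2) (i := 0)) (raug_hom R2).
  by move=> x /raug_inj ->; exact: (lin0 (raug_hom R2).1).
have T0 : ghom a0 /\ forall x, rdiff R1 0 x = 0 -> rdiff R2 0 (a0 x) = 0.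
  by split=> // x /(rexact0 R1).1[y <-]; rewrite a0E rdiff_raug.
pose r i (a : T i) (b : T i.+1) :=
  forall x, sval b (rdiff R1 i x) = rdiff R2 i (sval a x).
have [i [a [ha ka]]|s [s0 sr]] := @dependent_choice_seq T r _ (exist _ a0 T0).
  have [|b [hb bE]] := extend_along (rdiff_hom R1 i) (rdiff_hom R1 i.+1)
    (rexactS R1 i) (rterm_inj (r := R2) (i := i.+1))
    (ghom_comp ha (rdiff_hom R2 i)).
    exact: ka.
  have Tb : ghom b /\ forall x, rdiff R1 i.+1 x = 0 -> rdiff R2 i.+1 (b x) = 0.
    by split=> // x /(rexactS R1 i).1[y <-]; rewrite bE rdiff_rdiff.
  by exists (exist _ b Tb).
exists (fun i => sval (s i)); split=> [i|x|i x].
- by case: (s i) => b [].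
- by rewrite s0 /= a0E.
- exact: sr.
Qed.

(** The invariant is that c_{i+1} - d h_i vanishes on Ker d. It starts with c_0, which vanishes on
    Ker d_0, the image of N. *)
Lemma homotopy_ex (N : gmodule A) (R : rel_resolution CA N)
    (c : forall i, rterm R i -> rterm R i) :
  (forall i, ghom (c i)) -> (forall x, c 0%N (raug R x) = 0) ->
  (forall i x, c i.+1 (rdiff R i x) = rdiff R i (c i x)) ->
  exists h : forall i, rterm R i.+1 -> rterm R i,
    [/\ forall i, ghom (h i), forall x, c 0%N x = h 0%N (rdiff R 0 x)
      & forall i x, c i.+1 x = rdiff R i (h i x) + h i.+1 (rdiff R i.+1 x)].
Proof.
move=> hc c0 cd.
pose T i := {h : rterm R i.+1 -> rterm R i |
  ghom h /\ forall x, rdiff R i.+1 x = 0 -> c i.+1 x = rdiff R i (h x)}.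
have [|h0 [hh0 h0E]] := extend_along (rdiff_hom R 0) (rdiff_hom R 1)
  (rexactS R 0) (rterm_inj (r := R) (i := 0)) (hc 0%N).
  by move=> x /(rexact0 R).1[y <-].
have T0 : ghom h0 /\ forall x, rdiff R 1 x = 0 -> c 1%N x = rdiff R 0 (h0 x).
  by split=> // x /(rexactS R 0).1[y <-]; rewrite cd h0E.
pose r i (a : T i) (b : T i.+1) :=
  forall x, c i.+1 x = rdiff R i (sval a x) + sval b (rdiff R i.+1 x).
have [i [a [ha ka]]|s [s0 sr]] := @dependent_choice_seq T r _ (exist _ h0 T0).
  have [|b [hb bE]] := extend_along (rdiff_hom R i.+1) (rdiff_hom R i.+2)
    (rexactS R i.+1) (rterm_inj (r := R) (i := i.+1))
    (ghom_sub (hc i.+1) (ghom_comp ha (rdiff_hom R i))).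
    by move=> x /ka ->; rewrite subrr.
  have Tb : ghom b /\
      forall x, rdiff R i.+2 x = 0 -> c i.+2 x = rdiff R i.+1 (b x).
    split=> // x /(rexactS R i.+1).1[y <-]; rewrite cd bE.
    have ld := (rdiff_hom R i.+1).1.
    by rewrite (linD _ _ ld) -scaleN1r (linZ _ _ ld) rdiff_rdiff scaler0 addr0.
  by exists (exist _ b Tb) => x; rewrite /= bE addrC subrK.
exists (fun i => sval (s i)); split=> [i|x|i x].
- by case: (s i) => b [].
- by rewrite s0 /= h0E.
- exact: sr.
Qed.

End Comparison.

(** * Isomorphisms of relative Ext groups *)

Section ExtIsomorphisms.
Context (k : fieldType).

Lemma sq_class_linear (V : lmodType k) (Z B : V -> Prop) (sZ : subspace Z)
    (sB : subspace B) (c : k) (u v : subsp sZ) :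
  c *: sq_class sB u + sq_class sB v = sq_class sB (c *: u + v).
Proof. by rewrite -sq_addE -sq_scaleE. Qed.

(** Everything is required modulo B1 and B2 only: F may be neither injective nor onto Z2, as happens
    for chain maps between resolutions. *)
Lemma subquot_iso (V1 V2 : lmodType k) (Z1 B1 : V1 -> Prop) (Z2 B2 : V2 -> Prop)
    (sZ1 : subspace Z1) (sB1 : subspace B1)
    (sZ2 : subspace Z2) (sB2 : subspace B2) (F : V1 -> V2) :
  linear F -> (forall x, Z1 x -> Z2 (F x)) ->
  (forall x, Z1 x -> B2 (F x) <-> B1 x) ->
  (forall z, Z2 z -> exists x, Z1 x /\ B2 (F x - z)) ->
  exists phi : {linear subquot sZ1 sB1 -> subquot sZ2 sB2}, bijective phi.
Proof.
move=> lF FZ FB Fs.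
have FZs (x : subsp sZ1) : F (val x) \in subsp_pred sZ2.
  by apply/subsp_predP/FZ/subsp_predP; exact: valP x.
pose f (q : subquot sZ1 sB1) : subquot sZ2 sB2 :=
  sq_class sB2 (Subsp (FZs (sq_repr q))).
have lN (x y : V1) : F (x - y) = F x - F y.
  by rewrite -scaleN1r addrC lF scaleN1r addrC.
have valZ (x : subsp sZ1) : Z1 (val x) by apply/subsp_predP; exact: valP x.
have fE (x : subsp sZ1) : f (sq_class sB1 x) = sq_class sB2 (Subsp (FZs x)).
  apply/sq_classP; rewrite /= -lN; apply/FB; last exact: sq_reprP.
  by rewrite -scaleN1r addrC; exact: (sZ1.2 _ _ _ (valZ _) (valZ _)).
have lf : linear f.
  move=> c p q; rewrite -[p]sq_reprK -[q]sq_reprK.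
  move: (sq_repr p) (sq_repr q) => {p q} x y.
  rewrite (sq_class_linear sB1) fE (fE x) (fE y) sq_class_linear.
  by congr sq_class; apply: val_inj; rewrite /= lF.
pose phi : {linear subquot sZ1 sB1 -> subquot sZ2 sB2} :=
  HB.pack f (GRing.isLinear.Build _ _ _ _ f lf).
have phi_inj : injective phi.
  move=> p q; rewrite -[p]sq_reprK -[q]sq_reprK -[LHS]/(f _) -[RHS]/(f _) !fE.
  move=> /sq_classP; rewrite /= -lN => /FB e; apply/sq_classP; apply: e.
  by rewrite -scaleN1r addrC; exact: (sZ1.2 _ _ _ (valZ _) (valZ _)).
have phi_surj q : exists p, phi p = q.
  have Zq : Z2 (val (sq_repr q)) by apply/subsp_predP; exact: valP (sq_repr q).
  have [x [/(subsp_predP sZ1) Zx Bx]] := Fs _ Zq.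
  exists (sq_class sB1 (Subsp Zx)); rewrite -[LHS]/(f _) fE -[RHS]sq_reprK.
  exact/sq_classP.
exists phi; exists (fun q => sval (cid (phi_surj q))) => [p|q].
  by apply: phi_inj; case: cid.
by case: cid.
Qed.

Context (G : algGroup k).

Section ChangeOfResolution.
Context (A C : closedSubgroup G) (CA : subgroup_le C A) (M N : gmodule A).

(** The chain map v u - 1 kills the augmentation, so it is d h + h d; on a cocycle the term h d
    vanishes. *)
Lemma chain_map_homotopic_id (R R' : rel_resolution CA N)
    (u : forall i, rterm R i -> rterm R' i)
    (v : forall i, rterm R' i -> rterm R i) i (f : M -> rterm R i) :
  chain_map u -> chain_map v -> cocycle f ->
  coboundary (fun x => v i (u i (f x)) - f x).
Proof.
move=> [hu u0 ud] [hv v0 vd] [hf df].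
have hc j : ghom (fun x => v j (u j x) - x).
  by apply: ghom_sub (ghom_id _); exact: ghom_comp.
have [||h [hh h0 hS]] := homotopy_ex hc.
- by move=> x; rewrite u0 v0 subrr.
- move=> j x; have ld := (rdiff_hom R j).1.
  by rewrite ud vd (linD _ _ ld) -[- x]scaleN1r (linZ _ _ ld) scaleN1r.
case: i f hf df => [|j] f hf df /=.
  by apply/funext => x; rewrite h0 df (lin0 (hh 0%N).1).
exists (fun x => h j (f x)); split; first exact: ghom_comp.
by apply/funext => x; rewrite hS df (lin0 (hh j.+1).1) addr0.
Qed.

Lemma chain_map_cocycle (R R' : rel_resolution CA N)
    (u : forall i, rterm R i -> rterm R' i) i (f : M -> rterm R i) :
  chain_map u -> cocycle f -> cocycle (fun x => u i (f x)).
Proof.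
move=> [hu u0 ud] [hf df]; split=> [|x]; first exact: ghom_comp.
by rewrite -ud df (lin0 (hu i.+1).1).
Qed.

Lemma chain_map_coboundary (R R' : rel_resolution CA N)
    (u : forall i, rterm R i -> rterm R' i) i (f : M -> rterm R i) :
  chain_map u -> coboundary f -> coboundary (fun x => u i (f x)).
Proof.
move=> [hu u0 ud]; case: i f => [|j] f /=.
  by move=> ->; apply/funext => x; rewrite (lin0 (hu 0%N).1).
move=> [g [hg ->]]; exists (fun x => u j (g x)); split; first exact: ghom_comp.
by apply/funext => x; rewrite ud.
Qed.

Lemma relExt_change_resolution (R1 R2 : rel_resolution CA N) (i : nat) :
  exists phi : {linear relExt M R1 i -> relExt M R2 i}, bijective phi.
Proof.
have [a ca] := chain_map_ex R1 R2.
have [b cb] := chain_map_ex R2 R1.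
apply: (subquot_iso _ _ _ _ (F := fun (f : M -> rterm R1 i) x => a i (f x))).
- by move=> c f g; apply/funext => x; case: ca => ha _ _; exact: (ha i).1.
- by move=> f; exact: chain_map_cocycle.
- move=> f Zf; split=> [Bf|]; last exact: chain_map_coboundary.
  have sB := coboundary_subspace M R1 i.
  (* Write f = -(b a f - f) + b a f: the first term is a coboundary by homotopy, the second because
     a f is one. *)
  have h := subspN sB (chain_map_homotopic_id ca cb Zf).
  have := subspD sB h (chain_map_coboundary cb Bf).
  congr coboundary; apply/funext => x.
  by rewrite -[LHS]/(- (_ - _) + _) opprB subrK.
- move=> z Zz; exists (fun x => b i (z x)); split.
    exact: chain_map_cocycle.
  exact: (chain_map_homotopic_id cb ca Zz).
Qed.

End ChangeOfResolution.

(** Composition with the counit commutes with the differentials and is bijective on homomorphisms,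
    with inverse [transpose]. Identities are carried back to [ind] by [ind_hom_eq]. *)
Lemma relExt_frobenius (H K : closedSubgroup G)
    (HK : product_is_full H K \/ Mod_semisimple H)
    (M : gmodule (fullG G)) (N : gmodule H)
    (RH : rel_resolution (capG_lel H K) N) (i : nat) :
  exists phi : {linear relExt M (ind_resolution HK RH) i ->
                       relExt (res (le_full H) M) RH i}, bijective phi.
Proof.
set RI := ind_resolution HK RH.
have adj j (f : M -> ind (rterm RH j)) : ghom f ->
    ghom ((fun x => ind_counit (f x)) : res (le_full H) M -> rterm RH j).
  move=> hf; apply: (ghom_comp (N := res (le_full H) (ind (rterm RH j)))).
    exact: ghom_res hf.
  exact: ind_counit_hom.
have dE j (x : ind (rterm RH j)) :
    ind_counit (rdiff RI j x) = rdiff RH j (ind_counit x).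
  exact: ind_counit_map.
apply: (subquot_iso _ _ _ _
  (F := fun (f : M -> ind (rterm RH i)) (x : res (le_full H) M) =>
     ind_counit (f x))).
- by move=> c f g; apply/funext => x; exact: lin_ind_counit.
- move=> f [hf df]; split=> [|x]; first exact: adj.
  by rewrite -dE df (lin0 (@lin_ind_counit _ _ _ _)).
- move=> f [hf _]; case: i f hf => [|j] f hf /=.
    split=> [e|->]; apply/funext => x.
      (* In degree 0 a coboundary is 0, so f = 0 follows from uniqueness, by comparison with the
         zero homomorphism. *)
      have h0 : ghom (fun _ : M => 0 : ind (rterm RH 0)).
        exact: (ghom_subspace M (ind (rterm RH 0))).1.
      apply: (ind_hom_eq hf h0) => y; rewrite (lin0 (@lin_ind_counit _ _ _ _)).
      exact: (congr1 (@^~ y) e).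
    exact: (lin0 (@lin_ind_counit _ _ _ _)).
  split=> [[g [hg e]]|[g [hg ->]]]; last first.
    exists (fun x => ind_counit (g x)); split; first exact: adj.
    by apply/funext => x; rewrite -dE.
  exists (transpose hg); split; first exact: transpose_hom.
  apply/funext; apply: (ind_hom_eq hf).
    exact: ghom_comp (transpose_hom hg) (rdiff_hom RI j).
  by move=> x; rewrite dE transposeK; exact: (congr1 (@^~ x) e).
- move=> z [hz dz]; exists (transpose hz); split; last first.
    have -> : (fun x => ind_counit (transpose hz x)) - z = 0.
      apply/funext => x; rewrite -[LHS]/(_ - z x) transposeK; exact: subrr.
    exact: (coboundary_subspace _ RH i).1.
  split; first exact: transpose_hom.
  have h0 : ghom (fun _ : M => 0 : rterm RI i.+1).
    exact: (ghom_subspace M (rterm RI i.+1)).1.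
  apply: (ind_hom_eq _ h0) => [|x].
    exact: ghom_comp (transpose_hom hz) (rdiff_hom RI i).
  by rewrite dE transposeK dz (lin0 (@lin_ind_counit _ _ _ _)).
Qed.

End ExtIsomorphisms.

Theorem proposition5p5p1 (k : closedFieldType) (G : algGroup k)
    (H K : closedSubgroup G)
    (HK : product_is_full H K \/ Mod_semisimple H)
    (M : gmodule (fullG G)) (N : gmodule H)
    (RG : rel_resolution (le_full K) (ind N))
    (RH : rel_resolution (capG_lel H K) N) (i : nat) :
  exists phi : {linear relExt M RG i -> relExt (res (le_full H) M) RH i},
    bijective phi.
Proof.
have [a ba] := relExt_change_resolution M RG (ind_resolution HK RH) i.
have [b bb] := relExt_frobenius HK M RH i.
exists ((b \o a)%FUN : {linear _ -> _}); exact: bij_comp bb ba.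
Qed.
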